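(* Let $d\ge2$, $e\ge1$ and $r\ge3$. The group $B(de,e,r)\cong C_\infty^e\ltimes B(\widetilde{\mathbf{A}}_{r-1})$ has the following presentation. Generators: $\{z\}\cup\{s_i\mid 1\le i\le r\}$. Relations (indices of the $s_i$ taken modulo $r$, so $s_{r+1}=s_1$): - $(A_1)$ $s_is_j=s_js_i$ for $i-j\not\equiv\pm1\bmod r$; - $(A_2)$ $s_is_{i+1}s_i=s_{i+1}s_is_{i+1}$ for $1\le i\le r$; - $(A_3)$ $zs_i=s_iz$ for $3\le i\le r$; - $(A_4)$ $zs_1B=s_1Bz$; - $(A_5)$ $z\langle s_1B\rangle^{e(r-1)}=s_2z\langle s_1B\rangle^{e(r-1)-1}$; where $B=s_rs_{r-1}\cdots s_2$. Furthermore, on adding the relations $z^d=1$ and $s_i^2=1$ for all $1\le i\le r$, a presentation for the reflection group $G(de,e,r)$ is obtained, where the generators are all reflections.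
   Context: For a word $b_1b_2\cdots b_l$ and $k\ge0$, $\langle b_1b_2\cdots b_l\rangle^k$ denotes the cyclic product $b_1b_2\cdots b_lb_1b_2\cdots$ with exactly $k$ factors (letters). In $(A_5)$, $s_1B$ is regarded as the word $s_1s_rs_{r-1}\cdots s_2$ of length $r$. $G(de,e,r)$ is the group of $r\times r$ monomial matrices whose nonzero entries are $de$-th roots of unity and such that the $d$-th power of the product of the nonzero entries is $1$; a reflection is a nontrivial element fixing a complex hyperplane of $\mathbb{C}^r$ pointwise. The braid group $B(de,e,r)$ of $G(de,e,r)$ is the group with generators $z$, $t_i$ ($i\in\mathbb{Z}$), $s_3,\ldots,s_r$ and relations: $s_is_j=s_js_i$ for $|i-j|\ge2$; $s_is_{i+1}s_i=s_{i+1}s_is_{i+1}$ for $3\le i\le r-1$; $t_it_{i-1}=t_jt_{j-1}$ for $i,j\in\mathbb{Z}$; $s_3t_is_3=t_is_3t_i$ for $i\in\mathbb{Z}$; $s_jt_i=t_is_j$ for $i\in\mathbb{Z}$, $4\le j\le r$; $zt_i=t_{i-e}z$ for $i\in\mathbb{Z}$; $zs_j=s_jz$ for $3\le j\le r$. Adding $z^d=1$, $t_i^2=1$, $s_j^2=1$ gives $G(de,e,r)$, with $z\mapsto\operatorname{Diag}(\zeta^e,1,\ldots,1)$, $t_i\mapsto\begin{pmatrix}0&\zeta^{-i}\\ \zeta^i&0\end{pmatrix}\oplus I_{r-2}$, $s_j\mapsto$ permutation matrix of $(j-1\ \ j)$, $\zeta$ a primitive $de$-th root of unity. $B(\widetilde{\mathbf{A}}_{r-1})$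 is the group generated by $s_1,\ldots,s_r$ with relations $(A_1)$ and $(A_2)$. It is identified with the normal subgroup $B(\infty,\infty,r)$ of $B(de,e,r)$ generated by all $t_i$ and $s_3,\ldots,s_r$, via $s_1=At_1A^{-1}$ with $A=s_rs_{r-1}\cdots s_3$, $s_2=t_0$, and $s_j=s_j$ for $3\le j\le r$. $C_\infty^e=\langle z\rangle$ is infinite cyclic and acts on this subgroup by conjugation, $zt_iz^{-1}=t_{i-e}$, $zs_jz^{-1}=s_j$ ($3\le j\le r$). The generators $z,s_1,\ldots,s_r$ in the theorem are these elements. *)

(* Defs.v *)
From HB Require Import structures.
From mathcomp Require Import all_boot all_order perm all_algebra.
From mathcomp Require Import boolp classical_sets reals complex.

Set Implicit Arguments.
Unset Strict Implicit.
Unset Printing Implicit Defensive.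

Import GRing.Theory.

Local Open Scope quotient_scope.
Local Open Scope classical_set_scope.
Local Open Scope group_scope.

(* A letter is a pair (x, b), where (x, false) stands for x and (x, true) for
   its inverse. *)
Definition word (X : Type) := seq (X * bool).

Definition positive (X : Type) (u : seq X) : word X :=
  [seq (x, false) | x <- u].

Definition word_inv (X : Type) (u : word X) : word X :=
  rev [seq (l.1, ~~ l.2) | l <- u].

(* Every relation used below equates two positive words (words without
   inverses), so relations are given on seq X. *)
Definition relations (X : Type) := seq X -> seq X -> Prop.

Inductive congruent (X : Type) (rel : relations X) : word X -> word X -> Prop :=
| congruent_refl u : congruent rel u u
| congruent_sym u v : congruent rel u v -> congruent rel v u
| congruent_trans u v w :
    congruent rel u v -> congruent rel v w -> congruent rel u w
| congruent_cat u u' v v' :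
    congruent rel u u' -> congruent rel v v' ->
    congruent rel (u ++ v) (u' ++ v')
| congruent_cancel x b : congruent rel [:: (x, b); (x, ~~ b)] [::]
| congruent_rel u v : rel u v -> congruent rel (positive u) (positive v).

Definition weval (G : groupType) (X : Type) (g : X -> G) (w : word X) : G :=
  \prod_(l <- w) (if l.2 then (g l.1)^-1 else g l.1).

(* The canonical map from the group with generators X and relations rel to G
   that sends x to g x is well defined, injective, and has image N. *)
Definition is_presentation (G : groupType) (N : set G) (X : Type)
    (rel : relations X) (g : X -> G) : Prop :=
  (forall a : G, N a <-> exists w, weval g w = a) /\
  (forall u v, weval g u = weval g v <-> congruent rel u v).

Section PresentedGroup.

Variables (X : Type) (rel : relations X).

Lemma word_invK : involutive (@word_inv X).
Proof.
move=> u; rewrite /word_inv map_rev revK -map_comp -[RHS]map_id.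
by apply: eq_map => -[x b] /=; rewrite negbK.
Qed.

Lemma word_invV u : congruent rel (word_inv u ++ u) [::].
Proof.
elim: u => [|[x b] w IHw]; first exact: congruent_refl.
rewrite /word_inv map_cons rev_cons cat_rcons -/(word_inv w) /=.
apply: congruent_trans IHw.
apply: congruent_cat; first exact: congruent_refl.
rewrite -[_ :: _]/([:: (x, ~~ b); (x, b)] ++ w) -[X in congruent _ _ X]cat0s.
apply: congruent_cat; last exact: congruent_refl.
by rewrite -{2}(negbK b); apply: congruent_cancel.
Qed.

Lemma word_invr u : congruent rel (u ++ word_inv u) [::].
Proof. by have := word_invV (word_inv u); rewrite word_invK. Qed.

Lemma congruent_inv u v :
  congruent rel u v -> congruent rel (word_inv u) (word_inv v).
Proof.
move=> uv.
have step : congruent rel (word_inv u) (word_inv u ++ (v ++ word_inv v)).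
  rewrite -{1}[word_inv u]cats0; apply: congruent_cat.
    exact: congruent_refl.
  exact/congruent_sym/word_invr.
apply: congruent_trans step _.
rewrite catA -[X in congruent _ _ X]cat0s.
apply: congruent_cat; last exact: congruent_refl.
apply: congruent_trans (word_invV u).
apply: congruent_cat; first exact: congruent_refl.
exact: congruent_sym.
Qed.

Definition congruentb (u v : {classic (word X)}) : bool :=
  `[< congruent rel u v >].

Lemma congruentb_refl : reflexive congruentb.
Proof. by move=> u; apply/asboolP; apply: congruent_refl. Qed.

Lemma congruentb_sym : symmetric congruentb.
Proof. by move=> u v; apply/asboolP/asboolP; apply: congruent_sym. Qed.

Lemma congruentb_trans : transitive congruentb.
Proof.
move=> v u w /asboolP uv /asboolP vw; apply/asboolP.
exact: congruent_trans uv vw.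
Qed.

Canonical congruentb_equiv :=
  EquivRel congruentb congruentb_refl congruentb_sym congruentb_trans.

Definition presented : Type := {eq_quot congruentb}.

HB.instance Definition _ := Choice.on presented.

Definition presented_class (u : word X) : presented :=
  \pi_({eq_quot congruentb}) u.

Definition presented_repr (a : presented) : word X :=
  repr (a : {eq_quot congruentb}).

Lemma presented_classP u v :
  presented_class u = presented_class v <-> congruent rel u v.
Proof.
by split=> [/eqmodP/asboolP //|uv]; apply/eqmodP/asboolP.
Qed.

Lemma presented_reprK a : presented_class (presented_repr a) = a.
Proof. exact: reprK. Qed.

Lemma presented_classK u : congruent rel (presented_repr (presented_class u)) u.
Proof. by apply/presented_classP; rewrite presented_reprK. Qed.

Definition presented_mul (a b : presented) : presented :=
  presented_class (presented_repr a ++ presented_repr b).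

Definition presented_inv (a : presented) : presented :=
  presented_class (word_inv (presented_repr a)).

Lemma presented_mulE u v :
  presented_mul (presented_class u) (presented_class v)
  = presented_class (u ++ v).
Proof.
by apply/presented_classP; apply: congruent_cat; apply: presented_classK.
Qed.

Lemma presented_invE u :
  presented_inv (presented_class u) = presented_class (word_inv u).
Proof. by apply/presented_classP/congruent_inv/presented_classK. Qed.

Lemma presented_mulA : associative presented_mul.
Proof.
move=> a b c; rewrite -(presented_reprK a) -(presented_reprK b).
by rewrite -(presented_reprK c) !presented_mulE catA.
Qed.

Lemma presented_mul1 : left_id (presented_class [::]) presented_mul.
Proof. by move=> a; rewrite -(presented_reprK a) presented_mulE. Qed.

Lemma presented_mulr1 : right_id (presented_class [::]) presented_mul.
Proof. by move=> a; rewrite -(presented_reprK a) presented_mulE cats0. Qed.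

Lemma presented_mulV :
  left_inverse (presented_class [::]) presented_inv presented_mul.
Proof.
move=> a; rewrite -(presented_reprK a) presented_invE presented_mulE.
exact/presented_classP/word_invV.
Qed.

Lemma presented_mulrV :
  right_inverse (presented_class [::]) presented_inv presented_mul.
Proof.
move=> a; rewrite -(presented_reprK a) presented_invE presented_mulE.
exact/presented_classP/word_invr.
Qed.

HB.instance Definition _ := isGroup.Build presented presented_mulA
  presented_mul1 presented_mulr1 presented_mulV presented_mulrV.

Definition presented_gen (x : X) : presented := presented_class [:: (x, false)].

Lemma weval_presented_gen w : weval presented_gen w = presented_class w.
Proof.
elim: w => [|[x b] w IHw]; first by rewrite /weval big_nil.
rewrite /weval big_cons -/(weval presented_gen w) IHw /=.
case: b; last exact: presented_mulE [:: (x, false)] w.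
rewrite -[_^-1]/(presented_inv (presented_gen x)) presented_invE.
exact: presented_mulE [:: (x, true)] w.
Qed.

Lemma presented_is_presentation :
  is_presentation [set: presented] rel presented_gen.
Proof.
split=> [a|u v]; last by rewrite !weval_presented_gen; apply: presented_classP.
split=> // _; exists (presented_repr a).
by rewrite weval_presented_gen presented_reprK.
Qed.

End PresentedGroup.

Definition is_subgroup (G : groupType) (H : set G) : Prop :=
  [/\ H 1, forall a b, H a -> H b -> H (a * b) & forall a, H a -> H a^-1].

Definition subgroup_generated (G : groupType) (S : set G) : set G :=
  [set a | forall H : set G, is_subgroup H -> S `<=` H -> H a].

Definition is_normal (G : groupType) (N : set G) : Prop :=
  forall a b, N b -> N (a * b * a^-1).

Definition internal_semidirect_product (G : groupType) (K N : set G) : Prop :=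
  [/\ is_subgroup K, is_subgroup N, is_normal N, K `&` N = [set 1]
    & forall a : G, exists k n, [/\ K k, N n & a = k * n]].

Definition infinite_order (G : groupType) (a : G) : Prop :=
  forall n : nat, 0 < n -> a ^+ n <> 1.

Definition sindex (r : nat) : Type := {j : nat | 3 <= j <= r}.

Inductive braid_generator (r : nat) : Type :=
| gen_z
| gen_t of int
| gen_s of sindex r.

Arguments gen_z {r}.
Arguments gen_t {r} _.

Inductive braid_relation (e r : nat) : relations (braid_generator r) :=
| braid_s_s_comm (i j : sindex r) :
    (val i + 2 <= val j) || (val j + 2 <= val i) ->
    braid_relation e [:: gen_s i; gen_s j] [:: gen_s j; gen_s i]
| braid_s_s_braid (i j : sindex r) : val j = (val i).+1 ->
    braid_relation e [:: gen_s i; gen_s j; gen_s i]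
                     [:: gen_s j; gen_s i; gen_s j]
| braid_t_t (i j : int) :
    braid_relation e [:: gen_t i; gen_t (i - 1)%R]
                     [:: gen_t j; gen_t (j - 1)%R]
| braid_s_t_braid (k : sindex r) (i : int) : val k = 3 ->
    braid_relation e [:: gen_s k; gen_t i; gen_s k]
                     [:: gen_t i; gen_s k; gen_t i]
| braid_s_t_comm (j : sindex r) (i : int) : 4 <= val j ->
    braid_relation e [:: gen_s j; gen_t i] [:: gen_t i; gen_s j]
| braid_z_t (i : int) :
    braid_relation e [:: gen_z; gen_t i] [:: gen_t (i - e%:Z)%R; gen_z]
| braid_z_s (j : sindex r) :
    braid_relation e [:: gen_z; gen_s j] [:: gen_s j; gen_z].

(* The defining relations of B(de,e,r) do not involve d. *)
Definition braid_group (e r : nat) : groupType :=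
  presented (@braid_relation e r).

Section BraidGroup.

Variables e r : nat.

Definition braid_z : braid_group e r := presented_gen _ gen_z.

Definition braid_t (i : int) : braid_group e r := presented_gen _ (gen_t i).

(* The value 1 is a dummy for j outside [3, r]. *)
Definition braid_s (j : nat) : braid_group e r :=
  oapp (fun k : sindex r => presented_gen _ (gen_s k)) 1 (insub j).

(* A = s_r s_(r-1) ... s_3 *)
Definition braid_A : braid_group e r :=
  \prod_(j <- rev (iota 3 (r - 2))) braid_s j.

Definition braid_sigma (j : nat) : braid_group e r :=
  if j == 1%N then braid_A * braid_t 1%R * braid_A^-1
  else if j == 2 then braid_t 0%R
  else braid_s j.

(* Written B(infty,infty,r) in the literature; as a consequence of the defining
   relations it is normal and is an affine braid group of type A. *)
Definition affine_subgroup : set (braid_group e r) :=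
  subgroup_generated
    ([set braid_t i | i in [set: int]]
     `|` [set braid_s j | j in [set j | 3 <= j <= r]]).

(* The generators s_1, ..., s_r are indexed by residues modulo r, the residue
   of 0 standing for s_r. *)
Definition braid_affine_generator (i : 'Z_r) : braid_group e r :=
  braid_sigma (if i == 0 :> nat then r else i).

End BraidGroup.

Inductive affine_relation (r : nat) : relations 'Z_r :=
| affine_comm (i j : 'Z_r) : (i - j != 1)%R -> (i - j != - 1)%R ->
    affine_relation [:: i; j] [:: j; i]
| affine_braid (i : 'Z_r) :
    affine_relation [:: i; (i + 1)%R; i] [:: (i + 1)%R; i; (i + 1)%R].

Inductive affine_z_generator (r : nat) : Type :=
| agen_z
| agen_s of 'Z_r.

Arguments agen_z {r}.
Arguments agen_s {r} _.

(* The first k letters of the infinite word u u u ...; k copies of u suffice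
   as long as u is nonempty. *)
Definition cyclic_word (X : Type) (u : seq X) (k : nat) : seq X :=
  take k (flatten (nseq k u)).

(* s_1 B = s_1 s_r s_(r-1) ... s_2 *)
Definition s1B (r : nat) : seq (affine_z_generator r) :=
  [seq agen_s k%:R%R | k <- 1%N :: rev (iota 2 (r - 1))].

Inductive affine_z_relation (e r : nat) : relations (affine_z_generator r) :=
| affine_z_A1_A2 (u v : seq 'Z_r) : affine_relation u v ->
    affine_z_relation e (map agen_s u) (map agen_s v)
| affine_z_A3 (k : nat) : 3 <= k <= r ->
    affine_z_relation e [:: agen_z; agen_s k%:R%R] [:: agen_s k%:R%R; agen_z]
| affine_z_A4 :
    affine_z_relation e (agen_z :: s1B r) (rcons (s1B r) agen_z)
| affine_z_A5 :
    affine_z_relation e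
      (agen_z :: cyclic_word (s1B r) (e * (r - 1)%N))
      [:: agen_s 2%:R%R, agen_z & cyclic_word (s1B r) (e * (r - 1)%N - 1)].

Definition affine_z_element (e r : nat) (x : affine_z_generator r) :
    braid_group e r :=
  match x with
  | agen_z => braid_z e r
  | agen_s i => braid_affine_generator e i
  end.

Inductive reflection_relation (d e r : nat) : relations (affine_z_generator r) :=
| reflection_braid (u v : seq (affine_z_generator r)) :
    affine_z_relation e u v -> reflection_relation d e u v
| reflection_z_order : reflection_relation d e (nseq d agen_z) [::]
| reflection_s_order (i : 'Z_r) :
    reflection_relation d e [:: agen_s i; agen_s i] [::].

Arguments braid_relation e r _ _ : clear implicits.
Arguments braid_z e r : clear implicits.
Arguments affine_subgroup e r _ : clear implicits.
Arguments braid_t e r i : clear implicits.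
Arguments braid_s e r j : clear implicits.
Arguments braid_affine_generator e r i : clear implicits.
Arguments affine_relation r _ _ : clear implicits.
Arguments affine_z_relation e r _ _ : clear implicits.
Arguments affine_z_element e r x : clear implicits.
Arguments reflection_relation d e r _ _ : clear implicits.

Local Open Scope ring_scope.

Section Imprimitive.

Variables (C : fieldType) (d e r : nat).

Definition monomial (M : 'M[C]_r) : bool :=
  [forall i, #|[pred j | M i j != 0]| == 1%N]
  && [forall j, #|[pred i | M i j != 0]| == 1%N].

Definition in_imprimitive (M : 'M[C]_r) : bool :=
  [&& monomial M,
      [forall i, forall j, (M i j != 0) ==> (M i j ^+ (d * e) == 1)]
    & (\prod_i \prod_(j | M i j != 0) M i j) ^+ d == 1].

Lemma in_imprimitiveP (M : 'M[C]_r) :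
  reflect (exists (s : 'S_r) (a : 'I_r -> C),
    [/\ M = \matrix_(i, j) (a i *+ (s i == j)), forall i, a i != 0,
        forall i, a i ^+ (d * e) = 1 & (\prod_i a i) ^+ d = 1])
    (in_imprimitive M).
Proof.
have prodE (s : 'S_r) (a : 'I_r -> C) : (forall i, a i != 0) ->
    forall N : 'M[C]_r, (forall i j, N i j = a i *+ (s i == j)) ->
    \prod_i \prod_(j | N i j != 0) N i j = \prod_i a i.
  move=> a0 N NE; apply: eq_bigr => i _; rewrite (big_pred1 (s i)) => [|j].
    by rewrite NE eqxx.
  by rewrite /= NE (eq_sym j); case: (s i =P j) => _; rewrite ?mulr1n ?mulr0n ?eqxx ?a0.
apply: (iffP and3P) => [[/andP[/forallP row1 /forallP col1]]|].
  move=> /forallP entry /eqP det1.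
  have rowP i : {j | forall k, (M i k != 0) = (k == j)}.
    apply/cid; have /eqP/mem_card1[j jP] := row1 i.
    by exists j => k; have := jP k; rewrite !inE.
  pose f i := sval (rowP i).
  have fP i k : (M i k != 0) = (k == f i) by rewrite /f; case: (rowP i).
  have f_inj : injective f.
    move=> i i' ff; have /eqP/mem_card1[k kP] := col1 (f i).
    have := kP i; have := kP i'.
    by rewrite !inE !fP ff eqxx => /esym/eqP-> /esym/eqP->.
  have ME i j : M i j = M i (f i) *+ (perm f_inj i == j).
    rewrite permE eq_sym; case: (j =P f i) => [->//|/eqP ne].
    by apply/eqP; rewrite mulr0n -[_ == 0]negbK fP.
  have nz i : M i (f i) != 0 by rewrite fP.
  exists (perm f_inj), (fun i => M i (f i)); split=> //.
  - by apply/matrixP=> i j; rewrite mxE.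
  - by move=> i; have /forallP/(_ (f i))/implyP/(_ (nz i))/eqP := entry i.
  - by rewrite -(prodE (perm f_inj) _ nz M).
move=> [s [a [-> a0 ade ad]]].
have nzE i j : ((\matrix_(i, j) (a i *+ (s i == j))) i j != 0) = (s i == j).
  by rewrite mxE; case: (s i =P j) => _; rewrite ?mulr1n ?mulr0n ?eqxx ?a0.
split.
- apply/andP; split; apply/forallP => i.
    apply/eqP; rewrite -(card1 (s i)); apply: eq_card => j.
    by rewrite !inE nzE eq_sym.
  apply/eqP; rewrite -(card1 (s^-1%g i)); apply: eq_card => j.
  by rewrite !inE nzE (canF_eq (permK s)).
- apply/forallP=> i; apply/forallP=> j; apply/implyP; rewrite nzE => /eqP <-.
  by rewrite mxE eqxx mulr1n ade.
- by rewrite (prodE s a a0) ?ad // => i j; rewrite mxE.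
Qed.

Definition imprimitive_group : Type := {M : 'M[C]_r | in_imprimitive M}.

HB.instance Definition _ := SubChoice.on imprimitive_group.

Lemma in_imprimitive1 : in_imprimitive 1%:M.
Proof.
apply/in_imprimitiveP; exists 1%g, (fun=> 1); split=> [|i|i|].
- by apply/matrixP => i j; rewrite !mxE perm1.
- exact: oner_neq0.
- exact: expr1n.
- by rewrite big1 ?expr1n.
Qed.

Lemma in_imprimitiveM M N :
  in_imprimitive M -> in_imprimitive N -> in_imprimitive (M *m N).
Proof.
move=> /in_imprimitiveP[s [a [-> a0 ade ad]]].
move=> /in_imprimitiveP[t [b [-> b0 bde bd]]].
apply/in_imprimitiveP; exists (s * t)%g, (fun i => a i * b (s i)); split.
- apply/matrixP => i j; rewrite !mxE (bigD1 (s i)) //= big1 => [|k ne].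
    by rewrite !mxE eqxx mulr1n addr0 permM mulrnAr.
  by rewrite !mxE eq_sym (negbTE ne) mulr0n mul0r.
- by move=> i; rewrite mulf_neq0.
- by move=> i; rewrite exprMn ade bde mulr1.
- rewrite big_split exprMn ad mul1r.
  by rewrite (reindex_inj (@perm_inj _ s)) in bd.
Qed.

Lemma in_imprimitiveV M :
  in_imprimitive M -> (M \in unitmx) && in_imprimitive (invmx M).
Proof.
move=> /in_imprimitiveP[s [a [-> a0 ade ad]]].
set P := (X in X \in unitmx).
pose N : 'M[C]_r := \matrix_(i, j) ((a (s^-1%g i))^-1 *+ (s^-1%g i == j)).
have PN : P *m N = 1%:M.
  apply/matrixP => i j; rewrite !mxE (bigD1 (s i)) //= big1 => [|k ne].
    by rewrite !mxE eqxx mulr1n addr0 permK mulrnAr divff.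
  by rewrite !mxE eq_sym (negbTE ne) mulr0n mul0r.
have [Pu _] := mulmx1_unit PN; rewrite Pu /=.
have -> : invmx P = N by rewrite -[invmx P]mulmx1 -PN mulKmx.
apply/in_imprimitiveP; exists s^-1%g, (fun i => (a (s^-1%g i))^-1); split=> //.
- by move=> i; rewrite invr_eq0.
- by move=> i; rewrite exprVn ade invr1.
- have aE : \prod_i a (s^-1%g i) = \prod_i a i.
    by rewrite [RHS](reindex_inj (@perm_inj _ s^-1%g)).
  by rewrite prodfV exprVn aE ad invr1.
Qed.

Definition imprimitive_one : imprimitive_group := Sub 1%:M in_imprimitive1.

Definition imprimitive_mul (M N : imprimitive_group) : imprimitive_group :=
  Sub (val M *m val N) (in_imprimitiveM (valP M) (valP N)).

Definition imprimitive_inv (M : imprimitive_group) : imprimitive_group :=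
  Sub (invmx (val M)) (proj2 (andP (in_imprimitiveV (valP M)))).

Lemma imprimitive_unit (M : imprimitive_group) : val M \in unitmx.
Proof. by case/andP: (in_imprimitiveV (valP M)). Qed.

Lemma imprimitive_mulA : associative imprimitive_mul.
Proof. by move=> M N P; apply: val_inj; rewrite /= mulmxA. Qed.

Lemma imprimitive_mul1 : left_id imprimitive_one imprimitive_mul.
Proof. by move=> M; apply: val_inj; rewrite /= mul1mx. Qed.

Lemma imprimitive_mulr1 : right_id imprimitive_one imprimitive_mul.
Proof. by move=> M; apply: val_inj; rewrite /= mulmx1. Qed.

Lemma imprimitive_mulV :
  left_inverse imprimitive_one imprimitive_inv imprimitive_mul.
Proof.
by move=> M; apply: val_inj; rewrite /= mulVmx ?imprimitive_unit.
Qed.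

Lemma imprimitive_mulrV :
  right_inverse imprimitive_one imprimitive_inv imprimitive_mul.
Proof.
by move=> M; apply: val_inj; rewrite /= mulmxV ?imprimitive_unit.
Qed.

HB.instance Definition _ := isGroup.Build imprimitive_group imprimitive_mulA
  imprimitive_mul1 imprimitive_mulr1 imprimitive_mulV imprimitive_mulrV.

End Imprimitive.

Definition is_reflection (C : fieldType) (r : nat) (M : 'M[C]_r) : Prop :=
  M != 1%:M /\
  exists H : {vspace 'cV[C]_r},
    \dim H = (r - 1)%N /\ forall v, v \in H -> M *m v = v.

Section Matrices.

Variables (C : fieldType) (e r : nat) (zeta : C).

Definition z_matrix : 'M[C]_r :=
  diag_mx (\row_j if j == 0%N :> nat then zeta ^+ e else 1).

Definition t_matrix (i : int) : 'M[C]_r :=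
  \matrix_(a, b)
    match nat_of_ord a, nat_of_ord b with
    | 0, 1 => zeta ^ (- i)
    | 1, 0 => zeta ^ i
    | _, _ => ((1 < a)%N && (a == b))%:R
    end.

End Matrices.

(* Main.v *)
(* The affine group embeds into its extension by an element rho with
   rho s_(i+1) = s_i rho (push all rho to the right). In that extension
   y := rho (s_1 s_r ... s_3)^-1 commutes with s_3, ..., s_r and
   t_1 t_0 := y^-1 s_2 y s_2 commutes with y, so z |-> y^e,
   t_i |-> y^-i s_2 y^i, s_j |-> s_j is a morphism on B(de,e,r) that maps
   s_1, ..., s_r to themselves; hence these generate an affine braid group.
   Comparing rho^e with y^e yields
     <s_1 B>^(e(r-1)) = t_e <s_1 B>^(e(r-1)-1),
   so (A_5) says z t_e = t_0 z, while (A_3) and (A_4) say that z commutes with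
   s_3, ..., s_r and t_1 t_0. As t_e and t_1 t_0 generate all t_i, these relations
   determine the conjugation by z on the affine group.

   For the reflection group, induction on n: modulo the order relations, every
   word in z, t_i, s_3, ..., s_n is h c with h a word in z, t_i, s_3, ..., s_(n-1)
   (in z alone if n = 2) and c an explicit representative mapping the row vector
   e_n to zeta^k e_j. A word with trivial image has c = 1; conversely these
   representatives reduce any matrix of G(de,e,n) to one of G(de,e,n-1). *)
Require Import Defs.
From HB Require Import structures.
From mathcomp Require Import all_boot all_order perm all_algebra.
From mathcomp Require Import boolp classical_sets reals complex.
From mathcomp Require Import zify.
Import GRing.Theory.
Local Open Scope classical_set_scope.
Local Open Scope group_scope.

Set Implicit Arguments.
Unset Strict Implicit.
Unset Printing Implicit Defensive.

(** * Words and presented groups *)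

(** The formula for y comes from type B_r: the relations asked of y, s_2, ..., s_r are those of the
    Artin group of type B_r, and the choice of y amounts to rho = s_r ... s_2 y, the product of all
    its generators. Since z goes to y^e, conjugation by z becomes explicit in the extension, whereas
    inside the affine group t_i has no convenient expression in the s_j. The constants of (A_5) come
    from rho = y (s_1 s_r ... s_3): each rho contributes r-1 letters, so rho^e contributes e(r-1).
    The last of these letters is s_(2+e), and rho^e s_(2+e) = s_2 rho^e allows it to be cancelled,
    which leaves e(r-1)-1 letters on one side. For the reflection group the factorization h c fails
    in the braid group itself: it needs involutions. It is therefore carried out in any quotient of
    B(de,e,r) where the t_i and s_j square to 1, and applied to the group that the relations
    present. Faithfulness is obtained by looking at one basis vector at a time, so no group order is
    ever computed. *)

Section Words.

Variables (G : groupType) (X : Type) (g : X -> G).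

Lemma weval_cat u v : weval g (u ++ v) = weval g u * weval g v.
Proof. exact: big_cat. Qed.

Lemma weval_nil : weval g [::] = 1.
Proof. exact: big_nil. Qed.

Lemma weval_rcons w x b :
  weval g (rcons w (x, b)) = weval g w * (if b then (g x)^-1 else g x).
Proof. by rewrite -cats1 weval_cat /weval big_seq1. Qed.

Lemma weval_inv u : weval g (word_inv u) = (weval g u)^-1.
Proof.
elim: u => [|[x b] u IHu]; first by rewrite !weval_nil invg1.
rewrite /word_inv map_cons rev_cons -/(word_inv u) weval_rcons IHu.
by rewrite {2}/weval big_cons invgM; case: b => /=; rewrite ?invgK.
Qed.

Lemma weval_positive u : weval g (positive u) = \prod_(x <- u) g x.
Proof. exact: big_map. Qed.

Lemma weval_subgroup (H : set G) w :
  is_subgroup H -> (forall x, H (g x)) -> H (weval g w).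
Proof.
move=> [H1 HM HV] Hg; elim: w => [|[x b] w IHw]; first by rewrite weval_nil.
by rewrite /weval big_cons; apply: HM => //; case: b => //=; apply: HV.
Qed.

Lemma weval_image_subgroup : is_subgroup [set a | exists w, weval g w = a].
Proof.
split=> [|a b [u <-] [v <-]|a [u <-]]; first by exists [::]; apply: weval_nil.
  by exists (u ++ v); rewrite weval_cat.
by exists (word_inv u); rewrite weval_inv.
Qed.

Definition satisfies (rel : relations X) :=
  forall u v, rel u v -> \prod_(x <- u) g x = \prod_(x <- v) g x.

Lemma congruent_weval (rel : relations X) u v :
  satisfies rel -> congruent rel u v -> weval g u = weval g v.
Proof.
move=> relP; elim=> {u v} [//|//|u v w _ -> _ ->|u u' v v' _ IHu _ IHv|x b|] //.
- by rewrite !weval_cat IHu IHv.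
- rewrite /weval !big_cons !big_nil mulg1 /=.
  by case: b => /=; rewrite (mulgV, mulVg).
- by move=> u v uv; rewrite !weval_positive; apply: relP.
Qed.

End Words.

Section PresentedMap.

Variables (G : groupType) (X : Type) (rel : relations X) (g : X -> G).

Definition presented_map (gP : satisfies g rel) (a : presented rel) : G :=
  weval g (presented_repr a).

Variable gP : satisfies g rel.

Lemma presented_map_class w : presented_map gP (presented_class rel w) = weval g w.
Proof. exact: congruent_weval gP (presented_classK rel w). Qed.

Lemma presented_map_gen x : presented_map gP (presented_gen rel x) = g x.
Proof. by rewrite presented_map_class /weval big_seq1. Qed.

Lemma presented_mapF : {morph presented_map gP : a b / a / b}.
Proof.
move=> a b; rewrite -(presented_reprK a) -(presented_reprK b).
rewrite -[_ / _]/(presented_mul _ (presented_inv _)).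
by rewrite presented_invE presented_mulE !presented_map_class weval_cat weval_inv.
Qed.

HB.instance Definition _ :=
  isGroupMorphism.Build (presented rel) G (presented_map gP) presented_mapF.

End PresentedMap.

Lemma gmulf_weval (G H : groupType) (f : UMagmaMorphism.type G H) (X : Type)
  (g : X -> G) w : f (weval g w) = weval (f \o g) w.
Proof.
rewrite /weval gmulf_prod; apply: eq_bigr => -[x [] _] //=; exact: gmulfV.
Qed.

Lemma presented_gen_satisfies (X : Type) (rel : relations X) :
  satisfies (presented_gen rel) rel.
Proof.
move=> u v uv; rewrite -!weval_positive !weval_presented_gen.
exact/presented_classP/congruent_rel.
Qed.

Lemma presented_subgroup (X : Type) (rel : relations X) (H : set (presented rel)) a :
  is_subgroup H -> (forall x, H (presented_gen rel x)) -> H a.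
Proof.
by rewrite -(presented_reprK a) -weval_presented_gen; apply: weval_subgroup.
Qed.

(** * Chains of Artin generators *)

Section ArtinChains.

Variable G : groupType.
Implicit Types (x : nat -> G) (y z : G).

Definition braided y z := y * z * y = z * y * z.

Lemma braided_sym y z : braided y z -> braided z y.
Proof. by []. Qed.

Lemma braided_conj y z c : braided (y ^ c) (z ^ c) <-> braided y z.
Proof. by rewrite /braided -!conjMg; split=> [/conjg_inj|->]. Qed.

Lemma commute_conjJ y z c : commute (y ^ c) (z ^ c) <-> commute y z.
Proof. by rewrite /commute -!conjMg; split=> [/conjg_inj|->]. Qed.

(** This trade of one conjugator for the other drives the reductions of braid relations below. *)
Lemma braided_conjE y z : braided y z -> y ^ z^-1 = z ^ y.
Proof.
move=> yz; apply: (mulgI y); apply: (mulIg z).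
by rewrite /conjg invgK !mulgA mulgVK mulgV mul1g yz.
Qed.

Lemma involution_inv y : y * y = 1 -> y^-1 = y.
Proof. exact: mulg1_eq. Qed.

Lemma commute_conj y z : commute y z -> y ^ z = y.
Proof. by move=> yz; rewrite /conjg yz mulKg. Qed.

Lemma commute_conjV y z : commute y z -> y ^ z^-1 = y.
Proof. by move/commuteV/commute_conj. Qed.

Lemma commuteMl y y' z : commute y z -> commute y' z -> commute (y * y') z.
Proof.
by move=> yz y'z; apply/commute_sym/commuteM; apply: commute_sym.
Qed.

Definition artin x a b :=
  (forall i j, a <= i -> i.+1 < j -> j <= b -> commute (x i) (x j)) /\
  (forall i, a <= i -> i < b -> braided (x i) (x i.+1)).

Lemma artin_commute x a b i j : artin x a b ->
  a <= i <= b -> a <= j <= b -> (i.+1 < j) || (j.+1 < i) -> commute (x i) (x j).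
Proof.
case=> xC _ /andP[ai ib] /andP[aj jb] /orP[]; first by move/xC; apply.
by move=> ji; apply/commute_sym/xC.
Qed.

Lemma artinW x a b a' b' : a <= a' -> b' <= b -> artin x a b -> artin x a' b'.
Proof.
move=> aa bb [xC xB]; split=> [i j|i] *; last by apply: xB; lia.
by apply: xC; lia.
Qed.

Lemma eq_artin x x' a b :
  (forall i, a <= i <= b -> x i = x' i) -> artin x a b -> artin x' a b.
Proof.
move=> xx [xC xB]; split=> [i j|i] *; rewrite -!xx; try lia; last by apply: xB.
by apply: xC.
Qed.

(* x_(a+n-1) ... x_(a+1) x_a *)
Definition desc x a n := \prod_(j <- rev (iota a n)) x j.

Lemma desc0 x a : desc x a 0 = 1.
Proof. exact: big_nil. Qed.

Lemma descS x a n : desc x a n.+1 = x (a + n)%N * desc x a n.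
Proof. by rewrite /desc -addn1 iotaD rev_cat /= big_cons. Qed.

Lemma descSr x a n : desc x a n.+1 = desc x a.+1 n * x a.
Proof. by rewrite /desc /= rev_cons big_rcons. Qed.

Lemma eq_desc x x' a n :
  (forall i, a <= i < a + n -> x i = x' i) -> desc x a n = desc x' a n.
Proof.
move=> xx; apply: eq_big_seq => i; rewrite mem_rev mem_iota; exact: xx.
Qed.

Lemma desc_iota x a n :
  desc x a n = \prod_(m <- iota 0 n) x (a + n.-1 - m)%N.
Proof.
elim: n => [|n IHn]; first by rewrite desc0 big_nil.
rewrite descS IHn /= big_cons subn0 -[1%N]addn0 iotaDl big_map.
by congr (_ * _); apply: eq_big_seq => m; rewrite mem_iota => mn; congr x; lia.
Qed.

Lemma desc_commute x a n y :
  (forall i, a <= i < a + n -> commute y (x i)) -> commute y (desc x a n).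
Proof.
elim: n => [|n IHn] yx; first by rewrite desc0; apply: commute1.
rewrite descS; apply: commuteM; first by apply: yx; lia.
by apply: IHn => i ain; apply: yx; lia.
Qed.

(** The letter [x j.+1] passes the lower letters, one braid relation with [x j.+1 * x j] turns it
    into [x j], and this passes the higher letters. *)
Lemma desc_shift x a n j : artin x a (a + n).-1 -> a <= j -> j.+1 < a + n ->
  desc x a n * x j.+1 = x j * desc x a n.
Proof.
elim: n => [|n IHn] xA aj jn; first by lia.
have [jn'|jn'] := ltnP j.+1 (a + n).
  rewrite descS -mulgA IHn //; last by apply: artinW xA; lia.
  rewrite !mulgA; congr (_ * _); apply: (artin_commute xA); lia.
case: n => [|n] in IHn xA jn jn' *; first by lia.
have -> : j = (a + n)%N by lia.
rewrite !descS -addnS; set u := x (a + n)%N; set v := x (a + n.+1)%N.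
have vd : commute v (desc x a n).
  by apply: desc_commute => i ain; apply: (artin_commute xA); lia.
rewrite -!mulgA -vd !mulgA; congr (_ * _).
by rewrite /v addnS; apply/braided_sym/(proj2 xA); lia.
Qed.

(** Needed to close the affine cycle: for the chain t_1, s_3, ..., s_r it makes s_1 and s_r braided.
    In the induction [braided_conjE] rewrites the conjugate of [x a] as a conjugate of the newest
    letter, by an element commuting with the letter after it. *)
Lemma desc_braided x a n : artin x a (a + n).+1 ->
  braided (x a ^ (desc x a.+1 n)^-1) (x (a + n).+1).
Proof.
elim: n => [|n IHn] xA.
  by rewrite desc0 invg1 conjg1 addn0; apply: (proj2 xA); lia.
have /IHn IH : artin x a (a + n).+1 by apply: artinW xA; lia.
rewrite descS invgM conjgM addSn (braided_conjE IH) addnS.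
set y := x a ^ _ in IH *.
rewrite -[x (_ + n).+2](@commute_conj _ y).
  by apply/braided_conj/(proj2 xA); lia.
rewrite /y /conjg invgK; apply: commuteM.
  by apply: desc_commute => i ain; apply: (artin_commute xA); lia.
apply: commuteM; first by apply: (artin_commute xA); lia.
by apply/commuteV/desc_commute => i ain; apply: (artin_commute xA); lia.
Qed.

End ArtinChains.

Lemma big_seq2 (G : groupType) (X : Type) (g : X -> G) x y :
  \prod_(i <- [:: x; y]) g i = g x * g y.
Proof. by rewrite big_cons big_seq1. Qed.

Lemma big_seq3 (G : groupType) (X : Type) (g : X -> G) x y z :
  \prod_(i <- [:: x; y; z]) g i = g x * g y * g z.
Proof. by rewrite big_cons big_seq2 mulgA. Qed.

Lemma int_shift_ind (P : int -> Prop) k :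
  P k -> (forall i, P i <-> P (i + 1)%R) -> forall i, P i.
Proof.
move=> Pk PS i; rewrite -(subrK k i) addrC.
elim/int_rect: (i - k)%R => [|n /PS|n IHn]; first by rewrite addr0.
- by rewrite -addrA intS [(1 + _)%R]addrC.
- by apply/PS; rewrite -addrA intS opprD [(- _ - _)%R]addrC addrNK.
Qed.

(** * The affine relations and the rotation *)

Section AffineIndices.

Variable r : nat.
Hypothesis r_ge3 : 2 < r.

Definition zrep (i : 'Z_r) : nat := if i == 0 :> nat then r else i.

Lemma zrep_bounds i : 1 <= zrep i <= r.
Proof.
have r1 : 1 < r by lia.
have := ltn_ord i; rewrite /zrep [X in _ < X]Zp_cast //; case: eqP; lia.
Qed.

Lemma natr_zrep i : ((zrep i)%:R = i)%R.
Proof.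
rewrite /zrep; case: eqP => [i0|_]; last by rewrite natr_Zp.
by apply: val_inj; rewrite /= val_Zp_nat ?modnn ?i0 //; lia.
Qed.

Lemma eq_natr_Zp i j : ((i%:R == j%:R :> 'Z_r)%R) = (i == j %[mod r]).
Proof.
have r1 : 1 < r by lia.
by apply/eqP/eqP => [/(congr1 val)|ij]; [|apply: val_inj]; rewrite /= !val_Zp_nat.
Qed.

Lemma natr_Zp_inj i j : 1 <= i <= r -> 1 <= j <= r ->
  (i%:R = j%:R :> 'Z_r)%R -> i = j.
Proof.
move=> /andP[i1 ir] /andP[j1 jr] /eqP; rewrite eq_natr_Zp => /eqP.
have [->|ir'] := eqVneq i r; have [->|jr'] := eqVneq j r => //;
  rewrite ?modnn ?modn_small; lia.
Qed.

Lemma zrep_natr j : 1 <= j <= r -> zrep j%:R%R = j.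
Proof.
by move=> jr; apply: natr_Zp_inj => //; rewrite ?zrep_bounds // natr_zrep.
Qed.

Lemma natr_Zp_r : (r%:R = 0 :> 'Z_r)%R.
Proof. by apply/eqP; rewrite -[0%R]/(0%:R)%R eq_natr_Zp modnn mod0n. Qed.

(** Trades residues for integers between 1 and r: what remains is a linear chain and one braid
    relation closing the cycle, so the pair (1, r) is excepted from the commutations. *)
Lemma affine_satisfies (G : groupType) (x : nat -> G) :
  (forall i j, 1 <= i -> i.+1 < j -> j <= r -> (i != 1%N) || (j != r) ->
     commute (x i) (x j)) ->
  (forall i, 1 <= i < r -> braided (x i) (x i.+1)) -> braided (x r) (x 1%N) ->
  satisfies (fun i => x (zrep i)) (affine_relation r).
Proof.
move=> xC xB xB1 _ _ [i j|i]; last first.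
  rewrite !big_seq3; have [ir|] := ltnP (zrep i) r.
    have -> : zrep (i + 1)%R = (zrep i).+1.
      rewrite -{1}(natr_zrep i) natr1 zrep_natr //; lia.
    by apply: xB; have := zrep_bounds i; lia.
  move=> ri; have {ri}ir : zrep i = r by have := zrep_bounds i; lia.
  have -> : (i + 1 = 1%:R)%R by rewrite -{1}(natr_zrep i) ir natr_Zp_r add0r.
  by rewrite ir (@zrep_natr 1) //; lia.
rewrite !big_seq2 -/(commute _ _).
wlog le_ij : i j / zrep i <= zrep j => [wl ij ji|ij ji].
  have [|/ltnW ge_ij] := leqP (zrep i) (zrep j); first by move/wl; apply.
  by apply/commute_sym/wl => //; rewrite -opprB eqr_oppLR // opprK.
have [ai ir] := andP (zrep_bounds i); have [aj jr] := andP (zrep_bounds j).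
have [->//|ne_ij] := eqVneq (zrep i) (zrep j).
have [jS|ne_ij1] := eqVneq (zrep j) (zrep i).+1.
  have jE : j = (i + 1)%R by rewrite -(natr_zrep j) jS -natr1 natr_zrep.
  by rewrite jE opprD addrA subrr add0r eqxx in ji.
apply: xC; try lia; rewrite -negb_and; apply: contra ij => /andP[/eqP i1 /eqP jr'].
by rewrite -(natr_zrep i) -(natr_zrep j) i1 jr' natr_Zp_r subr0.
Qed.

(** Dropping one node of the cycle leaves a linear chain. The start is arbitrary so that a chain may
    run past r: the one from 3 ends at r + 1, which is s_1. *)
Lemma affine_artin (G : groupType) (g : 'Z_r -> G) a :
  satisfies g (affine_relation r) ->
  artin (fun j => g j%:R%R) a (a + (r - 2)).
Proof.
move=> gP; split=> [i j ai ij ja|i ai ia].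
  have : affine_relation r [:: j%:R; i%:R]%R [:: i%:R; j%:R]%R.
    have -> : j = (i + (j - i))%N by lia.
    apply: affine_comm; rewrite natrD addrAC subrr add0r.
      rewrite -[1%R]/(1%:R)%R eq_natr_Zp !modn_small; lia.
    rewrite -subr_eq0 opprK natr1 -[0%R]/(0%:R)%R eq_natr_Zp mod0n modn_small; lia.
  by move/gP; rewrite !big_seq2.
have := gP _ _ (affine_braid i%:R%R); rewrite !big_seq3 natr1; exact.
Qed.

End AffineIndices.

(* The affine group extended by an element rho (None) of infinite order with
   rho s_(i+1) = s_i rho. *)
Inductive rotation_relation (r : nat) : relations (option 'Z_r) :=
| rotation_affine (u v : seq 'Z_r) : affine_relation r u v ->
    rotation_relation (map some u) (map some v)
| rotation_shift (i : 'Z_r) :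
    rotation_relation [:: None; Some (i + 1)%R] [:: Some i; None].

Arguments rotation_relation r _ _ : clear implicits.

Section Rotation.

Variable r : nat.

Implicit Types (u v w : word (option 'Z_r)) (k : 'Z_r).

(** The exponent sum of rho, kept only modulo r: the shift of the indices depends on nothing
    else. *)
Fixpoint rotation_degree w : 'Z_r :=
  match w with
  | [::] => 0%R
  | (Some _, _) :: w' => rotation_degree w'
  | (None, b) :: w' => ((if b then -1 else 1) + rotation_degree w')%R
  end.

(* Moves every rho of rho^k w to the right end and drops it. *)
Fixpoint unrotate k w : word 'Z_r :=
  match w with
  | [::] => [::]
  | (Some i, b) :: w' => ((i - k)%R, b) :: unrotate k w'
  | (None, b) :: w' => unrotate (k + if b then -1 else 1)%R w'
  end.

Lemma rotation_degree_cat u v :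
  rotation_degree (u ++ v) = (rotation_degree u + rotation_degree v)%R.
Proof.
by elim: u => [|[[i|] b] u IHu] /=; rewrite ?add0r // IHu addrA.
Qed.

Lemma unrotate_cat k u v :
  unrotate k (u ++ v) = unrotate k u ++ unrotate (k + rotation_degree u)%R v.
Proof.
elim: u k => [|[[i|] b] u IHu] k /=; rewrite ?addr0 // IHu // addrA //.
Qed.

Lemma rotation_degree_some (u : seq 'Z_r) : rotation_degree (positive (map some u)) = 0%R.
Proof. by elim: u. Qed.

Lemma unrotate_some k (u : seq 'Z_r) :
  unrotate k (positive (map some u)) = positive (map (fun i => i - k)%R u).
Proof. by elim: u => //= i u ->. Qed.

Lemma affine_relation_shift k (u v : seq 'Z_r) : affine_relation r u v ->
  affine_relation r (map (fun i => i - k)%R u) (map (fun i => i - k)%R v).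
Proof.
case=> [i j ij ji|i] /=; first by apply: affine_comm; rewrite opprB addrA subrK.
by rewrite addrAC; apply: affine_braid.
Qed.

(** Makes [unrotate] well defined on the extension, in place of building a semidirect product. All
    [k] are needed at once because [unrotate_cat] reads the second factor at a shifted index; the
    affine relations survive since they are invariant under shifts. *)
Lemma unrotate_congruent u v : congruent (rotation_relation r) u v ->
  rotation_degree u = rotation_degree v /\
  forall k, congruent (affine_relation r) (unrotate k u) (unrotate k v).
Proof.
elim=> {u v} [u|u v _ [uv IH]|u v w _ [uv IHu] _ [vw IHv]
  |u u' v v' _ [uu IHu] _ [vv IHv]|x b|_ _ [u v uv|i]].
- by split=> // k; apply: congruent_refl.
- by split=> // k; apply: congruent_sym.
- by split=> [|k]; [rewrite uv | apply: congruent_trans (IHu k) (IHv k)].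
- split=> [|k]; first by rewrite !rotation_degree_cat uu vv.
  by rewrite !unrotate_cat uu; apply: congruent_cat.
- case: x => [i|] /=; split=> [|k]; rewrite ?addr0 //=; try exact: congruent_refl.
    exact: congruent_cancel.
  by case: b; rewrite /= (addNr, addrN).
- rewrite !rotation_degree_some; split=> // k; rewrite !unrotate_some.
  exact/congruent_rel/affine_relation_shift.
- by split=> //= k; rewrite opprD addrACA subrr addr0; apply: congruent_refl.
Qed.

Lemma rotation_gen_satisfies :
  satisfies (presented_gen (rotation_relation r) \o some) (affine_relation r).
Proof.
move=> u v uv; rewrite -!(big_map some xpredT).
exact/presented_gen_satisfies/rotation_affine.
Qed.

(** [unrotate 0] undoes the inclusion of words without rho, so the affine group embeds. *)
Lemma weval_rotation_inj (u v : word 'Z_r) :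
  weval (presented_gen (rotation_relation r) \o some) u =
  weval (presented_gen (rotation_relation r) \o some) v ->
  congruent (affine_relation r) u v.
Proof.
pose incl (w : word 'Z_r) := [seq (Some l.1, l.2) | l <- w].
have inclE (s : word 'Z_r) : weval (presented_gen (rotation_relation r) \o some) s =
               presented_class (rotation_relation r) (incl s).
  by rewrite -weval_presented_gen /weval big_map.
have inclK (s : word 'Z_r) : unrotate 0%R (incl s) = s.
  by elim: s => //= -[i b] s ->; rewrite subr0.
rewrite !inclE => /presented_classP/unrotate_congruent[_ /(_ 0%R)].
by rewrite !inclK.
Qed.

End Rotation.

(** * The group B(de,e,r) *)

Section BraidMap.

Variable G : groupType.
Implicit Types (a y : G) (x : nat -> G).

(** The conjugate y^-i a y^i for an integer i. It models t_i, with [y] acting as z does for e =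
    1. *)
Definition zconj a y (i : int) : G :=
  match i with Posz n => a ^ (y ^+ n) | Negz n => a ^ (y ^- n.+1) end.

Lemma zconj0 a y : zconj a y 0 = a.
Proof. exact: conjg1. Qed.

Lemma zconjS a y i : zconj a y (i + 1)%R = zconj a y i ^ y.
Proof.
case: i => [n|[|n]].
- have -> : (n%:Z + 1 = n.+1)%R by lia.
  by rewrite /= expgSr conjgM.
- by rewrite /= conjgKV conjg1.
- have -> : (Negz n.+1 + 1 = Negz n)%R by lia.
  by rewrite /= [y ^+ n.+2]expgS invgM conjgM conjgKV.
Qed.

Lemma zconjDn a y i n : zconj a y (i + n%:Z)%R = zconj a y i ^ (y ^+ n).
Proof.
elim: n => [|n IHn]; first by rewrite addr0 conjg1.
by rewrite intS (addrC 1%R) addrA zconjS IHn expgSr conjgM.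
Qed.

Variables (e r : nat) (y : G) (x : nat -> G).
Hypotheses (xA : artin x 2 r) (xy : forall j, 3 <= j <= r -> commute y (x j)).
Hypothesis r_ge3 : 2 < r.
Hypothesis y_tt : commute (x 2 ^ y * x 2) y.

Definition braid_gen_map (g : braid_generator r) : G :=
  match g with
  | gen_z => y ^+ e
  | gen_t i => zconj (x 2) y i
  | gen_s j => x (val j)
  end.

Lemma zconj_commute j i : 4 <= j <= r -> commute (x j) (zconj (x 2) y i).
Proof.
move=> jr; move: i; apply: (@int_shift_ind _ 0%R) => [|i].
  by rewrite zconj0; apply: (artin_commute xA); lia.
have xj : x j = x j ^ y by rewrite commute_conj //; apply/commute_sym/xy; lia.
by rewrite zconjS {2}xj commute_conjJ.
Qed.

Lemma zconj_braided i : braided (x 3) (zconj (x 2) y i).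
Proof.
move: i; apply: (@int_shift_ind _ 0%R) => [|i].
  by rewrite zconj0; apply/braided_sym/(proj2 xA).
have x3 : x 3 = x 3 ^ y by rewrite commute_conj //; apply/commute_sym/xy; lia.
by rewrite zconjS {2}x3 braided_conj.
Qed.

(** Conjugation by [y] raises both indices by one, so all these products are conjugate under powers
    of [y] to the one for i = 1, which [y] centralizes. *)
Lemma zconj_mul i : zconj (x 2) y i * zconj (x 2) y (i - 1)%R = x 2 ^ y * x 2.
Proof.
rewrite -[i in LHS](subrK 1%R); move: (i - 1)%R => {}i; rewrite addrK.
move: i; apply: (@int_shift_ind _ 0%R) => [|i]; first by rewrite zconjS zconj0.
rewrite 2!zconjS -conjMg -zconjS.
split=> [->|tt]; first exact: commute_conj.
by apply: (@conjg_inj _ y); rewrite tt (commute_conj y_tt).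
Qed.

(** The hypotheses are the relations of type B_r for [y], [x 2], ..., [x r]: [y_tt] is a disguise of
    y s_2 y s_2 = s_2 y s_2 y. Relations between t_i and s_j are conjugates by y^i of their
    instances at i = 0, and y^e shifts the index by e. *)
Lemma braid_satisfies : satisfies braid_gen_map (braid_relation e r).
Proof.
move=> _ _ [i j ij|i j ij|i j|k i k3|j i j4|i|j]; rewrite ?big_seq2 ?big_seq3 /=.
- by apply: (artin_commute xA); have := valP i; have := valP j; move: ij => /=; lia.
- by rewrite -/(braided _ _) ij; apply: (proj2 xA); have := valP i; have := valP j;
    move: ij => /=; lia.
- by rewrite !zconj_mul.
- by rewrite -/(braided _ _) k3; apply: zconj_braided.
- by apply: zconj_commute; have := valP j; rewrite j4 => /andP[_ ->].
- by rewrite -{1}(subrK e%:Z%R i) zconjDn -conjgC.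
- by apply/commute_sym/commuteX/commute_sym/xy/(valP j).
Qed.

End BraidMap.

Section BraidGroup.

Variables e r : nat.
Hypothesis r_ge3 : 2 < r.

Local Notation z := (braid_z e r).
Local Notation t := (braid_t e r).
Local Notation s := (braid_s e r).

Lemma braid_sE j : 3 <= j <= r ->
  exists2 k : sindex r, val k = j & s j = presented_gen (braid_relation e r) (gen_s k).
Proof. by move=> jr; rewrite /braid_s insubT; exists (Sub j jr). Qed.

Lemma braid_gen_s (k : sindex r) :
  presented_gen (braid_relation e r) (gen_s k) = s (val k).
Proof. by rewrite /braid_s valK. Qed.

Let rels := @presented_gen_satisfies _ (braid_relation e r).

Lemma braid_ss i j : 3 <= i <= r -> 3 <= j <= r -> (i.+1 < j) || (j.+1 < i) ->
  commute (s i) (s j).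
Proof.
move=> /braid_sE[k <- ->] /braid_sE[l <- ->] kl.
have /rels : braid_relation e r [:: gen_s k; gen_s l] [:: gen_s l; gen_s k].
  by apply: braid_s_s_comm; rewrite !addn2.
by rewrite !big_seq2.
Qed.

Lemma braid_sS i : 3 <= i < r -> braided (s i) (s i.+1).
Proof.
move=> ir; have [k kE ->] := @braid_sE i ltac:(lia).
have [l lE ->] := @braid_sE i.+1 ltac:(lia).
have /rels : braid_relation e r [:: gen_s k; gen_s l; gen_s k] [:: gen_s l; gen_s k; gen_s l].
  by apply: braid_s_s_braid; rewrite kE lE.
by rewrite !big_seq3.
Qed.

Lemma braid_tt i j : t i * t (i - 1)%R = t j * t (j - 1)%R.
Proof. by have := rels (braid_t_t e r i j); rewrite !big_seq2. Qed.

Lemma braid_ttS i : t (i + 1)%R * t i = t 1%R * t 0%R.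
Proof. by have := braid_tt (i + 1)%R 1%R; rewrite addrK. Qed.

Lemma braid_s3t i : braided (s 3) (t i).
Proof.
have [k k3 ->] := @braid_sE 3 ltac:(lia).
by have := rels (braid_s_t_braid e i k3); rewrite !big_seq3.
Qed.

Lemma braid_st j i : 4 <= j <= r -> commute (s j) (t i).
Proof.
move=> jr; have [k kE ->] := @braid_sE j ltac:(lia).
have k4 : 4 <= val k by lia.
by have := rels (braid_s_t_comm e i k4); rewrite !big_seq2.
Qed.

Lemma braid_zt i : z * t i = t (i - e%:Z)%R * z.
Proof. by have := rels (braid_z_t e r i); rewrite !big_seq2. Qed.

Lemma braid_zs j : 3 <= j <= r -> commute z (s j).
Proof.
by move=> /braid_sE[k _ ->]; have := rels (braid_z_s e k); rewrite !big_seq2.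
Qed.

(** Any single t_i can take the place of s_2 in front of the chain s_3, ..., s_r. *)
Definition tchain i j := if j == 2 then t i else s j.

Lemma tchain_artin i : artin (tchain i) 2 r.
Proof.
split=> [j k j2 jk kr|j j2 jr]; rewrite /tchain.
  have -> : (k == 2) = false by lia.
  case: eqP => [_|ne2]; last by apply: braid_ss; lia.
  by apply/commute_sym/braid_st; lia.
have -> : (j.+1 == 2) = false by lia.
case: eqP => [->|ne2]; last by apply: braid_sS; lia.
exact/braided_sym/braid_s3t.
Qed.

Lemma tchain_desc i a n : 3 <= a -> desc (tchain i) a n = desc s a n.
Proof. by move=> a3; apply: eq_desc => k; rewrite /tchain; case: eqP => //; lia. Qed.

Lemma braid_s_artin : artin s 3 r.
Proof.
apply: eq_artin (artinW _ _ (tchain_artin 0%R)) => // i; rewrite /tchain.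
by case: eqP => //; lia.
Qed.

Local Notation A := (braid_A e r).

Lemma braid_AE : A = desc s 3 (r - 2). Proof. by []. Qed.

Lemma braid_A_shift j : 3 <= j < r -> A * s j.+1 = s j * A.
Proof.
move=> jr; rewrite braid_AE; apply: desc_shift; try lia.
by apply: artinW braid_s_artin; lia.
Qed.

Lemma braid_zA : commute z A.
Proof.
by rewrite braid_AE; apply: desc_commute => j jr; apply: braid_zs; lia.
Qed.

Lemma braid_sigma1 : braid_sigma e r 1%N = t 1%R ^ A^-1.
Proof. by rewrite /braid_sigma /= /conjg invgK mulgA. Qed.

Lemma braid_sigma_tchain j : 2 <= j -> braid_sigma e r j = tchain 0%R j.
Proof. by rewrite /braid_sigma /tchain; case: eqP => //; lia. Qed.

Lemma braid_sigma_s j : 3 <= j -> braid_sigma e r j = s j.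
Proof. by rewrite /braid_sigma; case: eqP => [|_]; [lia|case: eqP => //; lia]. Qed.

Lemma braid_affine_satisfies :
  satisfies (braid_affine_generator e r) (affine_relation r).
Proof.
apply: (affine_satisfies r_ge3 (x := braid_sigma e r)) => [i j i1 ij jr ne|i ir|].
- have [i2|i2] := leqP 2 i.
    rewrite !braid_sigma_tchain //; last by lia.
    by apply: (artin_commute (tchain_artin 0%R)); lia.
  have -> : i = 1%N by lia.
  rewrite braid_sigma1 (@braid_sigma_s j); last by lia.
  (* Both elements are now conjugates by A^-1, of t_1 and of s_(j+1) with j + 1 >= 4. *)
  have sj : s j = s j.+1 ^ A^-1.
    rewrite /conjg invgK mulgA braid_A_shift ?mulgK //; lia.
  rewrite sj; apply/commute_conjJ.
  by apply/commute_sym/braid_st; lia.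
- have [i2|i2] := leqP 2 i.
    by rewrite !braid_sigma_tchain; last lia; first apply: (proj2 (tchain_artin 0%R)); lia.
  have -> : i = 1%N by lia.
  rewrite braid_sigma1 [braid_sigma e r 2]/(t 0%R) braid_AE.
  (* Write A = D s_3 with D = s_r ... s_4, which commutes with t_0. As s_3 t_1 s_3^-1 = t_1^-1 s_3
     t_1 and t_0 = t_1^-1 t_2 t_1, it remains that s_3 and t_2 are braided. *)
  have -> : (r - 2 = (r - 3).+1)%N by lia.
  rewrite descSr invgM conjgM (@braided_conjE _ (t 1%R)); last exact/braided_sym/braid_s3t.
  rewrite -[X in braided _ X](@commute_conjV _ _ (desc s 4 (r - 3))); last first.
    by apply: desc_commute => k kr; apply/commute_sym/braid_st; lia.
  apply/braided_conj; rewrite -/(t 0%R); have -> : t 0%R = t (1 + 1)%R ^ t 1%R.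
    by rewrite /conjg braid_ttS mulKg.
  exact/braided_conj/braid_s3t.
- rewrite braid_sigma1 braid_sigma_s // braid_AE; apply: braided_sym.
  (* Conjugating by s_r strips the leading factor of A and fixes s_r, which leaves [desc_braided]
     for t_1, s_3, ..., s_r. *)
  have -> : s r = s (3 + (r - 3))%N by congr (s _); lia.
  have -> : (r - 2 = (r - 3).+1)%N by lia.
  rewrite descS invgM conjgM -[X in braided _ X](@commute_conjV _ _ (s (3 + (r - 3))%N)) //.
  apply/braided_conj; rewrite -(@tchain_desc 1%R) //.
  by apply: (desc_braided (x := tchain 1%R)); apply: artinW (tchain_artin 1%R); lia.
Qed.

End BraidGroup.

(** * Generated subgroups *)

Section GeneratedSubgroups.

Variable G : groupType.
Implicit Types (S H : set G).

Lemma subgroup_generated_subgroup S : is_subgroup (subgroup_generated S).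
Proof.
split=> [H [] //|a b Sa Sb H Hg SH|a Sa H Hg SH].
  by have [_ HM _] := Hg; apply: HM; [apply: Sa | apply: Sb].
by have [_ _ HV] := Hg; apply: HV; apply: Sa.
Qed.

Lemma mem_subgroup_generated S a : S a -> subgroup_generated S a.
Proof. by move=> Sa H _ /(_ a Sa). Qed.

Lemma subgroup_prod H (I : eqType) (u : seq I) (F : I -> G) :
  is_subgroup H -> (forall i, i \in u -> H (F i)) -> H (\prod_(i <- u) F i).
Proof.
move=> [H1 HM _]; elim: u => [|i u IHu] HF; first by rewrite big_nil.
rewrite big_cons; apply: HM; first by apply: HF; rewrite mem_head.
by apply: IHu => j ju; apply: HF; rewrite inE ju orbT.
Qed.

Lemma subgroup_mulVr H a b : is_subgroup H -> H a -> H (a * b) -> H b.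
Proof.
by move=> [_ HM HV] Ha Hab; rewrite -(mulKg a b); apply: HM => //; apply: HV.
Qed.

Lemma subgroup_mulVl H a b : is_subgroup H -> H b -> H (a * b) -> H a.
Proof.
by move=> [_ HM HV] Hb Hab; rewrite -(mulgK b a); apply: HM => //; apply: HV.
Qed.

End GeneratedSubgroups.

(** * The morphism from B(de,e,r) to the extension by the rotation *)

Section RotationGroup.

Variables (e r : nat).
Hypothesis r_ge3 : 2 < r.

Local Notation What := (presented (rotation_relation r)).
Local Notation rgen := (presented_gen (rotation_relation r)).
Local Notation rho := (rgen None).

Let a (j : nat) : What := rgen (Some j%:R%R).

Lemma rho_shift i : rho * rgen (Some (i + 1)%R) = rgen (Some i) * rho.
Proof.
by have := presented_gen_satisfies (rotation_shift i); rewrite !big_seq2.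
Qed.

Lemma rho_shiftX k i :
  rho ^+ k * rgen (Some (i + k%:R)%R) = rgen (Some i) * rho ^+ k.
Proof.
elim: k i => [|k IHk] i; first by rewrite addr0 mul1g mulg1.
by rewrite expgS -mulgA -natr1 addrA addrAC IHk mulgA rho_shift !mulgA.
Qed.

Lemma rho_desc b n : rho * desc a b.+1 n = desc a b n * rho.
Proof.
elim: n => [|n IHn]; first by rewrite !desc0 mul1g mulg1.
by rewrite !descS mulgA addSn {1}/a -natr1 rho_shift -mulgA IHn mulgA.
Qed.

Let aA b : artin a b (b + (r - 2)).
Proof.
by apply: (@affine_artin r r_ge3 _ (rgen \o some)); apply: rotation_gen_satisfies.
Qed.

Let a_r1 : a r.+1 = a 1%N.
Proof. by rewrite /a -natr1 natr_Zp_r // add0r. Qed.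

(* In these coordinates z = rho (s_1 s_r ... s_3)^-1 acts on the affine group
   as the generator z of the case e = 1. *)
Definition rotation_z : What := rho * (desc a 3 (r - 1))^-1.

Local Notation y := rotation_z.
Local Notation A := (desc a 3 (r - 2)).

Let XE : desc a 3 (r - 1) = a 1%N * A.
Proof.
rewrite -a_r1; have -> : (r - 1 = (r - 2).+1)%N by lia.
by rewrite descS; congr (a _ * _); lia.
Qed.

(** Both rho and s_1 s_r ... s_3 turn s_(j+1) into s_j as it passes to their left, so their quotient
    commutes with s_j. For j = r this is where the chain up to index r + 1 is used. *)
Lemma rotation_z_commute j : 3 <= j <= r -> commute y (a j).
Proof.
move=> jr; have : desc a 3 (r - 1) * a j.+1 = a j * desc a 3 (r - 1).
  by apply: desc_shift; [apply: artinW (aA 3) | |]; lia.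
move=> Xa; have aX : (desc a 3 (r - 1))^-1 * a j = a j.+1 * (desc a 3 (r - 1))^-1.
  by apply: (mulgI (desc a 3 (r - 1))); rewrite mulVKg !mulgA Xa mulgK.
by rewrite /commute /rotation_z -mulgA aX mulgA {1}/a -natr1 rho_shift !mulgA.
Qed.

Lemma rotation_zA : commute y A.
Proof. by apply: desc_commute => j jr; apply: rotation_z_commute; lia. Qed.

Lemma rotation_desc2 : desc a 2 (r - 1) * y = rho.
Proof. by rewrite /rotation_z mulgA -rho_desc mulgK. Qed.

(** Ensures that A t_1 A^-1 will be sent to s_1. It compares rho = A s_2 y with rho = y s_1 A. *)
Lemma rotation_conj2 : a 2 ^ y = a 1%N ^ A.
Proof.
apply: (mulgI y); rewrite -conjgC /conjg [y * (_ * _)]mulgA (commuteV rotation_zA) -mulgA.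
apply: (mulgI A); rewrite mulVKg -[in RHS]XE divgK.
by rewrite -rotation_desc2 mulgA -descSr; congr (desc a 2 _ * _); lia.
Qed.

(** With X = s_1 s_r ... s_3 the product is A^-1 X s_2, where A commutes with y, and y X s_2 = rho
    s_2 = s_1 rho = s_1 A s_2 y = X s_2 y. *)
Lemma rotation_tt : commute (a 2 ^ y * a 2) y.
Proof.
have XB : desc a 3 (r - 1) * a 2 = a 1%N * desc a 2 (r - 1).
  rewrite -descSr descS; congr (_ * _).
  by rewrite -a_r1; congr a; lia.
rewrite rotation_conj2 /conjg -mulgA -XE; apply/commute_sym/commuteM.
  exact/commuteV/rotation_zA.
rewrite /commute [in RHS]XB -[in RHS]mulgA rotation_desc2 -rho_shift {1}/rotation_z.
by rewrite mulgA mulgVK; congr (_ * rgen (Some _)); rewrite natr1.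
Qed.

Lemma rotation_braid_satisfies :
  satisfies (braid_gen_map e y a) (braid_relation e r).
Proof.
apply: braid_satisfies => //; first by apply: artinW (aA 2); lia.
  exact: rotation_z_commute.
exact: rotation_tt.
Qed.

Definition braid_rotation : UMagmaMorphism.type (braid_group e r) What :=
  presented_map rotation_braid_satisfies.

Local Notation h := braid_rotation.

Lemma braid_rotation_t i : h (braid_t e r i) = zconj (a 2) y i.
Proof. exact: (presented_map_gen rotation_braid_satisfies (gen_t i)). Qed.

Lemma braid_rotation_s j : 3 <= j <= r -> h (braid_s e r j) = a j.
Proof.
move=> /(@braid_sE e)[k <- ->].
exact: (presented_map_gen rotation_braid_satisfies (gen_s k)).
Qed.

Lemma braid_rotation_A : h (braid_A e r) = A.
Proof.
rewrite gmulf_prod; apply: eq_big_seq => j; rewrite mem_rev mem_iota => jr.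
by apply: braid_rotation_s; lia.
Qed.

Lemma braid_rotation_affine i :
  h (braid_affine_generator e r i) = rgen (Some i).
Proof.
rewrite -[in RHS](natr_zrep r_ge3 i) /braid_affine_generator -/(zrep i).
have := zrep_bounds r_ge3 i; move: (zrep i) => j jr.
have [j3|j3] := leqP 3 j.
  by rewrite braid_sigma_s // braid_rotation_s //; lia.
have [->|->] : j = 1%N \/ j = 2%N by lia.
  rewrite braid_sigma1 gmulfJ gmulfV braid_rotation_A braid_rotation_t.
  by rewrite -(add0r (1%R : int)) zconjS zconj0 rotation_conj2 conjgK.
by rewrite [braid_sigma e r 2]/(braid_t e r 0%R) braid_rotation_t zconj0.
Qed.

Lemma rotation_prod_shift k n :
  \prod_(m <- iota 0 n) rgen (Some (1 - m%:R)%R) * rho ^+ k =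
  rho ^+ k * \prod_(m <- iota 0 n) rgen (Some (1 - m%:R + k%:R)%R).
Proof.
elim: (iota 0 n) => [|m s IHs]; first by rewrite !big_nil mul1g mulg1.
by rewrite !big_cons mulgA rho_shiftX -!mulgA IHs.
Qed.

Lemma natr_mul_pred k : ((k * (r - 1))%N%:R = - k%:R :> 'Z_r)%R.
Proof.
apply/eqP; rewrite -addr_eq0 -natrD -mulnSr.
have -> : (r - 1).+1 = r by lia.
by rewrite natrM natr_Zp_r // mulr0.
Qed.

(** The indices 1 - m spell the cyclic word on s_1 B. Pushing the factor s_1 s_r ... s_3 of a new
    rho past rho^k raises its indices by k; as k = -k(r-1) modulo r, its letters continue the word
    exactly where it stopped. *)
Lemma rhoX k : rho ^+ k =
  y ^+ k * \prod_(m <- iota 0 (k * (r - 1))) rgen (Some (1 - m%:R)%R).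
Proof.
elim: k => [|k IHk]; first by rewrite mul0n big_nil mul1g.
have XE' : desc a 3 (r - 1) = \prod_(m <- iota 0 (r - 1)) rgen (Some (1 - m%:R)%R).
  rewrite desc_iota; apply: eq_big_seq => m; rewrite mem_iota => mr.
  have -> : (3 + (r - 1).-1 - m = r + 1 - m)%N by lia.
  by rewrite /a natrB ?natrD ?natr_Zp_r ?add0r //; lia.
rewrite expgS -[X in X * _ = _](mulgVK (desc a 3 (r - 1))) -/y -mulgA XE'.
rewrite rotation_prod_shift IHk !mulgA -expgS -mulgA; congr (_ * _).
rewrite mulSn addnC iotaD big_cat; congr (_ * _).
rewrite -[(0 + _)%N]addn0 iotaDl big_map; apply: eq_bigr => m _.
by rewrite add0n natrD natr_mul_pred opprD opprK addrCA addrC.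
Qed.

(** This is rho^e s_(2+e) = s_2 rho^e, with rho^e expanded by [rhoX] and s_2 y^e = y^e t_e; then y^e
    and a final s_(2+e) cancel. *)
Lemma rotation_A5 : 0 < e ->
  \prod_(m <- iota 0 (e * (r - 1))) rgen (Some (1 - m%:R)%R) =
  zconj (a 2) y e%:Z%R *
    \prod_(m <- iota 0 (e * (r - 1) - 1)) rgen (Some (1 - m%:R)%R).
Proof.
move=> e0; set Y := fun n => \prod_(m <- iota 0 n) rgen (Some (1 - m%:R)%R).
rewrite -!/(Y _); set N := (e * (r - 1))%N.
have N0 : 0 < N by rewrite muln_gt0 e0; lia.
(* The last letter has index 1 - (N - 1) = 2 - N, and N = -e modulo r. *)
have YS : Y N = Y (N - 1)%N * rgen (Some (2%:R + e%:R)%R).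
  rewrite -{1}(subnK N0) /Y iotaD big_cat big_seq1 add0n; congr (_ * rgen (Some _)).
  by rewrite natrB // natr_mul_pred opprB opprK addrA -[(1 + 1)%R]/(2%:R)%R.
apply: (mulIg (rgen (Some (2%:R + e%:R)%R))); rewrite -mulgA -YS.
apply: (mulgI (y ^+ e)); rewrite mulgA -rhoX rho_shiftX.
by rewrite -[Posz e]add0r zconjDn zconj0 mulgA -conjgC -mulgA -rhoX.
Qed.

End RotationGroup.

(** * The affine subgroup and the semidirect product *)

Section AffineSubgroup.

Variables (e r : nat).
Hypothesis r_ge3 : 2 < r.

Local Notation B := (braid_group e r).
Local Notation z := (braid_z e r).
Local Notation t := (braid_t e r).
Local Notation s := (braid_s e r).
Local Notation N := (affine_subgroup e r).
Local Notation sg := (braid_affine_generator e r).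

Lemma affine_subgroup_t i : N (t i).
Proof. by apply: mem_subgroup_generated; left; exists i. Qed.

Lemma affine_subgroup_s j : 3 <= j <= r -> N (s j).
Proof. by move=> jr; apply: mem_subgroup_generated; right; exists j. Qed.

Lemma affine_subgroup_subgroup : is_subgroup N.
Proof. exact: subgroup_generated_subgroup. Qed.

Lemma affine_subgroup_A : N (braid_A e r).
Proof.
apply: subgroup_prod => [|j]; first exact: affine_subgroup_subgroup.
by rewrite mem_rev mem_iota => jr; apply: affine_subgroup_s; lia.
Qed.

Lemma affine_subgroup_gen i : N (sg i).
Proof.
have [_ NM NV] := affine_subgroup_subgroup.
rewrite /braid_affine_generator -/(zrep i).
have := zrep_bounds r_ge3 i; move: (zrep i) => j jr.
have [j3|j3] := leqP 3 j.
  by rewrite braid_sigma_s //; apply: affine_subgroup_s; lia.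
have [->|->] : j = 1%N \/ j = 2%N by lia.
  rewrite braid_sigma1 /conjg invgK; apply: (NM); first exact: affine_subgroup_A.
  by apply: NM; [apply: affine_subgroup_t | apply: NV; apply: affine_subgroup_A].
exact: affine_subgroup_t.
Qed.

Lemma braid_affine_generator_natr j : 1 <= j <= r -> sg j%:R%R = braid_sigma e r j.
Proof. by move=> jr; rewrite /braid_affine_generator -/(zrep _) zrep_natr. Qed.

Lemma braid_affine_generator_s j : 3 <= j <= r -> sg j%:R%R = s j.
Proof. by move=> jr; rewrite braid_affine_generator_natr ?braid_sigma_s //; lia. Qed.

Lemma braid_affine_generator2 : sg 2%:R%R = t 0%R.
Proof. by rewrite braid_affine_generator_natr //; lia. Qed.

Lemma braid_affine_generator1 : sg 1%R = t 1%R ^ (braid_A e r)^-1.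
Proof. by rewrite (@braid_affine_generator_natr 1) ?braid_sigma1 //; lia. Qed.

(* t_i t_(i-1) does not depend on i, so one t_k and this product give all t_i. *)
Lemma subgroup_t (H : set B) k :
  is_subgroup H -> H (t k) -> H (t 1%R * t 0%R) -> forall i, H (t i).
Proof.
move=> Hg Hk Htt; apply: (@int_shift_ind _ k) => // i; rewrite -(braid_ttS e r i) in Htt.
by split=> Hi; [apply: subgroup_mulVl Htt | apply: subgroup_mulVr Htt].
Qed.

Lemma affine_subgroup_min (H : set B) : is_subgroup H ->
  (forall i, H (t i)) -> (forall j, 3 <= j <= r -> H (s j)) -> N `<=` H.
Proof. by move=> Hg Ht Hs a /(_ H Hg); apply=> b [[i _ <-]|[j jr <-]]; auto. Qed.

(** From the s_i one recovers t_0 = s_2 and t_1 = A^-1 s_1 A, hence all t_i. *)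
Lemma affine_subgroupP a : N a <-> exists w, weval sg w = a.
Proof.
split=> [|[w <-]]; last first.
  exact: weval_subgroup affine_subgroup_subgroup affine_subgroup_gen.
have Hg := weval_image_subgroup sg; set H := [set b | _] in Hg.
have Hsg i : H (sg i) by exists [:: (i, false)]; rewrite /weval big_seq1.
have Hs j : 3 <= j <= r -> H (s j) by move=> jr; rewrite -braid_affine_generator_s.
have [_ HM HV] := Hg; have HA : H (braid_A e r).
  apply: (subgroup_prod (H := H)) => // j; rewrite mem_rev mem_iota => jr; apply: Hs; lia.
have Ht0 : H (t 0%R) by rewrite -braid_affine_generator2.
have Ht1 : H (t 1%R).
  rewrite -[t 1%R](conjgK (braid_A e r)^-1) -braid_affine_generator1 invgK /conjg.
  by apply: (HM); [apply: HV | apply: (HM)].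
apply: (@affine_subgroup_min H) => //.
by apply: (@subgroup_t _ 0%R) => //; apply: (HM).
Qed.

Lemma affine_presentation : is_presentation N (affine_relation r) sg.
Proof.
split=> [|u v]; first exact: affine_subgroupP.
split=> [uv|]; last exact/congruent_weval/braid_affine_satisfies.
apply: weval_rotation_inj.
have hE w : braid_rotation e r_ge3 (weval sg w) =
            weval (presented_gen (rotation_relation r) \o some) w.
  rewrite gmulf_weval; apply: eq_bigr => -[i b] _ /=.
  by rewrite braid_rotation_affine.
by rewrite -!hE uv.
Qed.

(** Identities in N may thus be checked in the extension, where rho is available. *)
Lemma braid_rotation_inj a b : N a -> N b ->
  braid_rotation e r_ge3 a = braid_rotation e r_ge3 b -> a = b.
Proof.
move=> /affine_subgroupP[u <-] /affine_subgroupP[v <-]; rewrite !gmulf_weval.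
have hE w : weval (braid_rotation e r_ge3 \o sg) w =
            weval (presented_gen (rotation_relation r) \o some) w.
  by apply: eq_bigr => -[i c] _ /=; rewrite braid_rotation_affine.
rewrite !hE => /weval_rotation_inj; apply: congruent_weval.
exact: braid_affine_satisfies.
Qed.

Lemma braid_A5 : 0 < e ->
  \prod_(m <- iota 0 (e * (r - 1))) sg (1 - m%:R)%R =
  t e%:Z%R * \prod_(m <- iota 0 (e * (r - 1) - 1)) sg (1 - m%:R)%R.
Proof.
move=> e0; have [_ NM _] := affine_subgroup_subgroup.
have NY n : N (\prod_(m <- iota 0 n) sg (1 - m%:R)%R).
  apply: subgroup_prod => [|m _]; first exact: affine_subgroup_subgroup.
  exact: affine_subgroup_gen.
apply: braid_rotation_inj => //; first exact: NM (affine_subgroup_t _) (NY _).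
rewrite gmulfM !gmulf_prod braid_rotation_t.
under eq_bigr do rewrite braid_rotation_affine.
by under [in RHS]eq_bigr do rewrite braid_rotation_affine; apply: rotation_A5.
Qed.

Lemma braid_subgroup (H : set B) a : is_subgroup H ->
  H z -> (forall i, H (t i)) -> (forall j, 3 <= j <= r -> H (s j)) -> H a.
Proof.
move=> Hg Hz Ht Hs; apply: presented_subgroup => // -[|i|k] //; first exact: Ht.
by rewrite braid_gen_s; apply/Hs/(valP k).
Qed.

Lemma affine_subgroup_normal : is_normal N.
Proof.
have [_ NM NV] := affine_subgroup_subgroup.
(* Conjugation in both directions is recorded so that [H] is closed under inverses. *)
pose H := [set a : B | (forall b, N b -> N (b ^ a)) /\ (forall b, N b -> N (b ^ a^-1))].
suff HT a : H a by move=> a b Nb; have [_ /(_ b Nb)] := HT a; rewrite /conjg invgK mulgA.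
apply: braid_subgroup => [|||j jr].
- split=> [|b c [b1 b2] [c1 c2]|b [b1 b2]]; first by split=> b; rewrite ?invg1 conjg1.
    by split=> x Nx; rewrite ?invgM conjgM; [apply: c1; apply: b1 | apply: b2; apply: c2].
  by split=> x Nx; rewrite ?invgK; [apply: b2 | apply: b1].
- have sub (x : B) : is_subgroup [set b : B | N (b ^ x)].
    split=> [|b c|b] /=; rewrite ?conj1g ?conjMg ?conjVg; [|exact: NM|exact: NV].
    by have [] := affine_subgroup_subgroup.
  have zt i : t i ^ z^-1 = t (i - e%:Z)%R by rewrite /conjg invgK mulgA braid_zt mulgK.
  split=> b.
    apply: (affine_subgroup_min (sub z)) => [i|j jr] /=.
      by rewrite -(addrK e%:Z%R i) -zt conjgKV; apply: affine_subgroup_t.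
    by rewrite commute_conj; [apply: affine_subgroup_s | apply/commute_sym/braid_zs].
  apply: (affine_subgroup_min (sub z^-1)) => [i|j jr] /=.
    by rewrite zt; apply: affine_subgroup_t.
  by rewrite commute_conjV; [apply: affine_subgroup_s | apply/commute_sym/braid_zs].
- move=> i; have Ni := affine_subgroup_t i.
  split=> b Nb; rewrite /conjg ?invgK; first by apply: (NM); [apply: NV|apply: NM].
  by apply: (NM) => //; apply: NM => //; apply: NV.
- have Nj := affine_subgroup_s jr.
  split=> b Nb; rewrite /conjg ?invgK; first by apply: (NM); [apply: NV|apply: NM].
  by apply: (NM) => //; apply: NM => //; apply: NV.
Qed.

(** Respected by every relation, it descends to a morphism to the integers that is trivial on N and
    faithful on powers of z. *)
Definition z_degree (w : word (braid_generator r)) : int :=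
  (\sum_(l <- w) if l.1 is gen_z then (if l.2 then -1 else 1) else 0)%R.

Lemma z_degree_cat u v : z_degree (u ++ v) = (z_degree u + z_degree v)%R.
Proof. exact: big_cat. Qed.

Lemma z_degree_congruent u v :
  congruent (braid_relation e r) u v -> z_degree u = z_degree v.
Proof.
elim=> {u v} [//|//|u v w _ -> _ ->|u u' v v' _ IHu _ IHv|x b|] //.
- by rewrite !z_degree_cat IHu IHv.
- by rewrite /z_degree !big_cons !big_nil /=; case: x b => [|i|k] [].
- by move=> _ _ [i j _|i j _|i j|k i _|j i _|i|j]; rewrite /z_degree !big_cons !big_nil.
Qed.

Definition braid_degree (a : B) : int := z_degree (presented_repr a).

Lemma braid_degree_class w :
  braid_degree (presented_class (braid_relation e r) w) = z_degree w.
Proof. exact/z_degree_congruent/presented_classK. Qed.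

Lemma braid_degreeM a b : braid_degree (a * b) = (braid_degree a + braid_degree b)%R.
Proof.
rewrite -(presented_reprK a) -(presented_reprK b).
rewrite -[_ * _]/(presented_mul _ _) presented_mulE !braid_degree_class.
exact: z_degree_cat.
Qed.

Lemma braid_degree1 : braid_degree 1 = 0%R.
Proof. by apply: (addrI (braid_degree 1)); rewrite -braid_degreeM mulg1 addr0. Qed.

Lemma braid_degreeV a : braid_degree a^-1 = (- braid_degree a)%R.
Proof.
by apply/eqP; rewrite -addr_eq0 -braid_degreeM mulVg braid_degree1.
Qed.

Lemma braid_degree_zX n : braid_degree (z ^+ n) = n%:Z%R.
Proof.
elim: n => [|n IHn]; first exact: braid_degree1.
rewrite expgS braid_degreeM IHn braid_degree_class /z_degree big_seq1 /=.
by rewrite intS.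
Qed.

Lemma braid_z_infinite_order : infinite_order z.
Proof.
by move=> n n0 /(congr1 braid_degree); rewrite braid_degree_zX braid_degree1; lia.
Qed.

Lemma affine_subgroup_degree a : N a -> braid_degree a = 0%R.
Proof.
apply: (@affine_subgroup_min [set a | braid_degree a = 0%R]) => [|i|j jr] /=.
- split=> [|b c /= b0 c0|b /= b0]; first exact: braid_degree1.
    by rewrite braid_degreeM b0 c0.
  by rewrite braid_degreeV b0 oppr0.
- by rewrite braid_degree_class /z_degree big_seq1.
- have [k _ ->] := @braid_sE e _ _ jr.
  by rewrite braid_degree_class /z_degree big_seq1.
Qed.

Lemma generated_zP a : subgroup_generated [set z] a ->
  exists m n, a = z ^+ m * z ^- n.
Proof.
move=> /(_ [set b | exists m n, b = z ^+ m * z ^- n]).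
apply; last by move=> _ ->; exists 1%N, 0%N; rewrite invg1 mulg1.
split=> [|_ _ [m [n ->]] [m' [n' ->]]|_ [m [n ->]]].
- by exists 0%N, 0%N; rewrite invg1 mulg1.
- exists (m + m')%N, (n' + n)%N; rewrite !expgnDr invgM -!mulgA; congr (_ * _).
  rewrite !mulgA; congr (_ * _).
  exact/commute_sym/commuteV/commuteX2/commute_refl.
- by exists n, m; rewrite invgM invgK.
Qed.

Lemma braid_semidirect :
  internal_semidirect_product (subgroup_generated [set z]) N.
Proof.
have Ng := affine_subgroup_subgroup; have [N1 NM NV] := Ng.
have Kg := subgroup_generated_subgroup [set z]; have [K1 KM KV] := Kg.
have NJ := affine_subgroup_normal.
split=> //.
- apply/seteqP; split=> [a [Ka Na]|_ ->]; last by split; [apply: K1|apply: N1].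
  have [m [n aE]] := generated_zP Ka; have := affine_subgroup_degree Na.
  rewrite aE braid_degreeM braid_degreeV !braid_degree_zX => /eqP.
  by rewrite subr_eq0 => /eqP[->]; rewrite mulgV.
- pose H := [set a : B | exists k n, [/\ subgroup_generated [set z] k, N n & a = k * n]].
  move=> a; suff: H a by []; apply: braid_subgroup => [||i|j jr].
  + split=> [|_ _ [k [n [Kk Nn ->]]] [k' [n' [Kk' Nn' ->]]]|_ [k [n [Kk Nn ->]]]].
    * by exists 1, 1; rewrite mulg1.
    * exists (k * k'), (n ^ k' * n'); split; first exact: KM.
        apply: (NM) => //; have := NJ k'^-1 n Nn.
        by rewrite /conjg invgK mulgA.
      have := conjgC n k'; move: (n ^ k') => c nk.
      by rewrite -!mulgA [n * (_ * _)]mulgA nk !mulgA.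
    * exists k^-1, (n^-1 ^ k^-1); split; first exact: KV.
        by rewrite /conjg invgK mulgA; apply: NJ; apply: NV.
      by rewrite invgM -conjgC.
  + exists z, 1; rewrite mulg1; split=> //; exact: mem_subgroup_generated.
  + by exists 1, (t i); rewrite mul1g; split=> //; apply: affine_subgroup_t.
  + by exists 1, (s j); rewrite mul1g; split=> //; apply: affine_subgroup_s.
Qed.

End AffineSubgroup.

(** * The presentation of B(de,e,r) by z and s_1, ..., s_r *)

Lemma cyclic_wordE (X : Type) (x0 : X) (u : seq X) k : 0 < size u ->
  cyclic_word u k = [seq nth x0 u (m %% size u) | m <- iota 0 k].
Proof.
move=> u0; rewrite /cyclic_word; suff -> : flatten (nseq k u) =
    [seq nth x0 u (m %% size u) | m <- iota 0 (k * size u)].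
  by rewrite -map_take take_iota (minn_idPl _) // leq_pmulr.
elim: k => [|k IHk] //=; rewrite IHk mulSn iotaD map_cat; congr (_ ++ _).
  rewrite -[LHS](mkseq_nth x0); apply/eq_in_map => m; rewrite mem_iota => mu.
  by rewrite modn_small.
rewrite add0n -[size u in RHS]addn0 iotaDl -map_comp addn0.
by apply: eq_map => m /=; rewrite modnDl.
Qed.

(** Modulo r the word s_1 B reads s_1 s_0 s_(-1) ... s_(2-r): each letter lowers the index by one,
    also from one copy to the next. *)
Lemma cyclic_word_s1B r k : 2 < r ->
  cyclic_word (s1B r) k = [seq agen_s (1 - m%:R)%R | m <- iota 0 k].
Proof.
move=> r3; have sz : size (s1B r) = r by rewrite size_map /= size_rev size_iota; lia.
rewrite (cyclic_wordE (agen_s 0%R)) sz; last by lia.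
apply: eq_map => m; have mr : m %% r < r by rewrite ltn_mod; lia.
have -> : (m%:R = (m %% r)%:R :> 'Z_r)%R.
  by apply/eqP; rewrite (eq_natr_Zp r3) modn_mod.
move: (m %% r)%N mr => {}m mr; rewrite (nth_map 0) /= ?size_rev ?size_iota; last by lia.
case: m mr => [|m] mr /=; first by rewrite subr0.
rewrite nth_rev ?size_iota ?nth_iota; try lia.
have -> : (2 + (r - 1 - m.+1) = r + 1 - m.+1)%N by lia.
by rewrite natrB ?natrD ?natr_Zp_r ?add0r //; lia.
Qed.

Section AffineZ.

Variables (e r : nat).
Hypotheses (r_ge3 : 2 < r) (e_gt0 : 0 < e).

Local Notation B := (braid_group e r).
Local Notation z := (braid_z e r).
Local Notation t := (braid_t e r).
Local Notation s := (braid_s e r).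
Local Notation N := (affine_subgroup e r).
Local Notation sg := (braid_affine_generator e r).
Local Notation elt := (affine_z_element e r).

Lemma affine_z_elementE w : weval elt [seq (agen_s l.1, l.2) | l <- w] = weval sg w.
Proof. by rewrite /weval big_map. Qed.

(** In s_1 B = (A t_1 A^-1) (A t_0) the inner factors cancel. *)
Lemma braid_s1B : \prod_(x <- s1B r) elt x = braid_A e r * (t 1%R * t 0%R).
Proof.
have restE : \prod_(j <- rev (iota 2 (r - 1))) sg j%:R%R = braid_A e r * t 0%R.
  have -> : (r - 1 = (r - 2).+1)%N by lia.
  rewrite /= rev_cons big_rcons braid_affine_generator2 //; congr (_ * _).
  apply: eq_big_seq => j; rewrite mem_rev mem_iota => jr.
  by rewrite braid_affine_generator_s //; lia.
by rewrite big_map big_cons /= braid_affine_generator1 // restE /conjg invgK !mulgA mulgVK.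
Qed.

Lemma braid_z_tt : commute z (t 1%R * t 0%R).
Proof.
rewrite /commute mulgA braid_zt -mulgA braid_zt mulgA sub0r; congr (_ * _).
by rewrite addrC -[RHS](braid_ttS e r (- e%:Z)%R).
Qed.

Lemma affine_z_satisfies : satisfies elt (affine_z_relation e r).
Proof.
move=> _ _ [u v uv|k kr||].
- by rewrite !big_map; apply: braid_affine_satisfies.
- by rewrite !big_seq2 /= braid_affine_generator_s //; apply: braid_zs.
- rewrite big_cons big_rcons braid_s1B; apply: commuteM; last exact: braid_z_tt.
  exact: braid_zA.
- rewrite !cyclic_word_s1B // !big_cons !big_map /= braid_A5 // braid_affine_generator2 // !mulgA.
  by rewrite braid_zt subrr.
Qed.

Local Notation W := (presented (affine_relation r)).
Local Notation wg := (presented_gen (affine_relation r)).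
Local Notation P := (presented (affine_z_relation e r)).
Local Notation pg := (presented_gen (affine_z_relation e r)).

(** [W] is the bridge from [B] to [P]: an equation between affine elements of [B] is pulled back
    through this injective map and pushed on by [affine_z_incl]. *)
Definition affine_incl : UMagmaMorphism.type W B :=
  presented_map (braid_affine_satisfies e r_ge3).

Lemma affine_incl_gen i : affine_incl (wg i) = sg i.
Proof. exact: (presented_map_gen (braid_affine_satisfies e r_ge3)). Qed.

Lemma affine_incl_inj : injective affine_incl.
Proof.
move=> a b; rewrite -(presented_reprK a) -(presented_reprK b).
rewrite -!weval_presented_gen !gmulf_weval.
have E w : weval (affine_incl \o wg) w = weval sg w.
  by apply: eq_bigr => -[i c] _ /=; rewrite affine_incl_gen.
rewrite !E !weval_presented_gen => ab; apply/presented_classP.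
by apply/(proj2 (affine_presentation e r_ge3)).
Qed.

Lemma affine_incl_surj a : N a -> exists w, affine_incl w = a.
Proof.
move=> /(affine_subgroupP r_ge3)[w <-]; exists (weval wg w).
by rewrite gmulf_weval; apply: eq_bigr => -[i c] _ /=; rewrite affine_incl_gen.
Qed.

Lemma agen_s_satisfies : satisfies (pg \o agen_s) (affine_relation r).
Proof.
move=> u v uv; have := presented_gen_satisfies (affine_z_A1_A2 e uv).
by rewrite !big_map.
Qed.

Definition affine_z_incl : UMagmaMorphism.type W P := presented_map agen_s_satisfies.

Lemma affine_z_incl_gen i : affine_z_incl (wg i) = pg (agen_s i).
Proof. exact: (presented_map_gen agen_s_satisfies). Qed.

Local Notation inc := affine_incl.
Local Notation inz := affine_z_incl.

Section Lift.

Variable tW : int -> W.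
Hypothesis tWE : forall i, inc (tW i) = t i.

Lemma affine_lift_t0 : tW 0%R = wg 2%:R%R.
Proof. by apply: affine_incl_inj; rewrite tWE affine_incl_gen braid_affine_generator2. Qed.

(** The one defining relation of [B] given neither by the affine relations nor by (A_3). *)
Lemma affine_lift_z i : pg agen_z * inz (tW i) = inz (tW (i - e%:Z)%R) * pg agen_z.
Proof.
have rels := @presented_gen_satisfies _ (affine_z_relation e r).
(* The elements of the affine group whose conjugation by z is already
   determined by A_3, A_4 and A_5. *)
pose H := [set w : W | exists2 w', inc w' = z * inc w * z^-1 &
                                   pg agen_z * inz w = inz w' * pg agen_z].
have Hg : is_subgroup H.
  split=> [|w v [w' w'E wz] [v' v'E vz]|w [w' w'E wz]].
  - by exists 1; rewrite !gmulf1 mulg1 ?mulgV // mul1g.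
  - exists (w' * v'); last by rewrite !gmulfM mulgA wz -mulgA vz mulgA.
    by rewrite !gmulfM w'E v'E !mulgA mulgVK.
  - exists w'^-1; first by rewrite !gmulfV w'E !invgM invgK !mulgA.
    by rewrite !gmulfV; apply: (mulgI (inz w')); rewrite mulVKg mulgA -wz mulgK.
have Hs j : 3 <= j <= r -> H (wg j%:R%R).
  move=> jr; exists (wg j%:R%R); rewrite ?affine_incl_gen ?affine_z_incl_gen.
    by rewrite braid_affine_generator_s // braid_zs // mulgK.
  by have := rels _ _ (affine_z_A3 e jr); rewrite !big_seq2.
pose AW := \prod_(j <- rev (iota 3 (r - 2))) wg j%:R%R.
have AWE : inc AW = braid_A e r.
  rewrite gmulf_prod; apply: eq_big_seq => j; rewrite mem_rev mem_iota => jr.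
  by rewrite affine_incl_gen braid_affine_generator_s //; lia.
have HA : H AW.
  apply: (subgroup_prod (H := H)) => // j; rewrite mem_rev mem_iota => jr.
  by apply: Hs; lia.
have Htt : H (tW 1%R * tW 0%R).
  (* (A_4) concerns s_1 B = A t_1 t_0; as A lies in [H], membership of t_1 t_0 follows. *)
  apply: subgroup_mulVr HA _ => //.
  pose DW := \prod_(k <- 1%N :: rev (iota 2 (r - 1))) wg k%:R%R.
  have DWE : inc DW = braid_A e r * (t 1%R * t 0%R).
    rewrite -braid_s1B big_map gmulf_prod; apply: eq_bigr => k _.
    exact: affine_incl_gen.
  have <- : DW = AW * (tW 1%R * tW 0%R).
    by apply: affine_incl_inj; rewrite DWE !gmulfM AWE !tWE.
  exists DW.
    rewrite DWE -braid_s1B; have := affine_z_satisfies (affine_z_A4 e r).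
    by rewrite big_cons big_rcons => ->; rewrite mulgK.
  have := rels _ _ (affine_z_A4 e r); rewrite big_cons big_rcons big_map.
  by rewrite gmulf_prod; under [in X in _ -> X]eq_bigr do rewrite affine_z_incl_gen.
have Hte : H (tW e%:Z%R).
  exists (tW 0%R); first by rewrite !tWE braid_zt subrr mulgK.
  pose Y n := \prod_(m <- iota 0 n) wg (1 - m%:R)%R.
  have YE n : inc (Y n) = \prod_(m <- iota 0 n) sg (1 - m%:R)%R.
    by rewrite gmulf_prod; apply: eq_bigr => m _; rewrite affine_incl_gen.
  have YzE n : inz (Y n) = \prod_(m <- iota 0 n) pg (agen_s (1 - m%:R)%R).
    by rewrite gmulf_prod; apply: eq_bigr => m _; rewrite affine_z_incl_gen.
  have YW : Y (e * (r - 1))%N = tW e%:Z%R * Y (e * (r - 1) - 1)%N.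
    by apply: affine_incl_inj; rewrite gmulfM !YE tWE braid_A5.
  (* Right multiplication by the shorter word turns z t_e = t_0 z into (A_5). *)
  apply: (mulIg (inz (Y (e * (r - 1) - 1)%N))).
  rewrite -mulgA -gmulfM -YW affine_lift_t0 affine_z_incl_gen !YzE.
  have := rels _ _ (affine_z_A5 e r); rewrite !cyclic_word_s1B // !big_cons !big_map.
  by rewrite mulgA.
have Ht : forall i, H (tW i).
  apply: (@int_shift_ind _ e%:Z%R) => // {}i.
  have E : tW (i + 1)%R * tW i = tW 1%R * tW 0%R.
    by apply: affine_incl_inj; rewrite !gmulfM !tWE braid_ttS.
  by rewrite -E in Htt; split=> Hi; [apply: subgroup_mulVl Htt | apply: subgroup_mulVr Htt].
(* [H] only provides some [w]; it is identified by its image z t_i z^-1 = t_(i-e) in [B]. *)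
have [w wE ->] := Ht i; congr (inz _ * _); apply: affine_incl_inj.
by rewrite wE !tWE braid_zt mulgK.
Qed.

Definition affine_z_lift (x : braid_generator r) : P :=
  match x with
  | gen_z => pg agen_z
  | gen_t i => inz (tW i)
  | gen_s k => pg (agen_s (val k)%:R%R)
  end.

(** Relations without z hold in the affine subgroup, so they lift to [W] and pass to [P]; the two
    others are [affine_lift_z] and (A_3). *)
Lemma affine_z_lift_satisfies : satisfies affine_z_lift (braid_relation e r).
Proof.
pose gW (x : braid_generator r) : W :=
  match x with gen_z => 1 | gen_t i => tW i | gen_s k => wg (val k)%:R%R end.
pose no_z (x : braid_generator r) := if x is gen_z then false else true.
have step u v : braid_relation e r u v -> all no_z u -> all no_z v ->
    \prod_(x <- u) affine_z_lift x = \prod_(x <- v) affine_z_lift x.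
  have inzE w : all no_z w ->
      \prod_(x <- w) affine_z_lift x = inz (\prod_(x <- w) gW x).
    rewrite gmulf_prod; elim: w => [|[|i|k] w IHw] //= wz; rewrite ?big_nil //.
      by rewrite !big_cons IHw.
    by rewrite !big_cons IHw //= affine_z_incl_gen.
  have incE w : all no_z w ->
      inc (\prod_(x <- w) gW x) = \prod_(x <- w) presented_gen (braid_relation e r) x.
    rewrite gmulf_prod; elim: w => [|[|i|k] w IHw] //= wz; rewrite ?big_nil //.
      by rewrite !big_cons IHw //= tWE.
    rewrite !big_cons IHw //= affine_incl_gen braid_affine_generator_s ?braid_gen_s //.
    exact: (valP k).
  move=> uv uz vz; rewrite !inzE //; congr (inz _); apply: affine_incl_inj.
  by rewrite !incE //; apply: presented_gen_satisfies.
move=> u v uv; have := step u v uv.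
case: uv => [i j _|i j _|i j|k i _|j i _|i|j] no_zP; try exact: no_zP.
  by rewrite !big_seq2; apply: affine_lift_z.
rewrite !big_seq2 /=.
by have := presented_gen_satisfies (affine_z_A3 e (valP j)); rewrite !big_seq2.
Qed.

(** Not immediate for s_1, which is no generator of [B]. The affine elements on which the map agrees
    with the passage through [W] form a subgroup containing all t_i and s_j, hence s_1. *)
Lemma affine_z_lift_elt x : presented_map affine_z_lift_satisfies (elt x) = pg x.
Proof.
set k : UMagmaMorphism.type B P := presented_map affine_z_lift_satisfies.
have kE y : k (presented_gen _ y) = affine_z_lift y := presented_map_gen _ y.
case: x => [|i]; first exact: (kE gen_z).
pose H := [set a : B | exists2 w, inc w = a & k a = inz w].
have Hg : is_subgroup H.
  split=> [|a b [w wa ka] [v vb kb]|a [w wa ka]].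
  - by exists 1; rewrite !gmulf1.
  - by exists (w * v); rewrite !gmulfM ?wa ?vb ?ka ?kb.
  - by exists w^-1; rewrite !gmulfV ?wa ?ka.
have [|j jr||w wE kw] := @affine_subgroup_min e r H Hg _ _ (sg i).
- by move=> j; exists (tW j) => //; apply: (kE (gen_t j)).
- exists (wg j%:R%R); rewrite ?affine_incl_gen ?braid_affine_generator_s // affine_z_incl_gen.
  by have [l <- ->] := @braid_sE e _ _ jr; apply: (kE (gen_s l)).
- exact: affine_subgroup_gen.
rewrite [LHS]kw -affine_z_incl_gen; congr (inz _).
by apply: affine_incl_inj; rewrite wE affine_incl_gen.
Qed.

End Lift.

(** The preimages of the t_i in [W] are merely chosen; injectivity gives them every relation that
    the t_i satisfy. *)
Lemma affine_z_inverse :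
  exists k : UMagmaMorphism.type B P, forall x, k (elt x) = pg x.
Proof.
have [tW tWE] : {tW & forall i, inc (tW i) = t i}.
  by apply: (boolp.choice (P := fun i w => inc w = t i)) => i;
    apply: affine_incl_surj; apply: affine_subgroup_t.
by exists (presented_map (affine_z_lift_satisfies tWE)) => x; apply: affine_z_lift_elt.
Qed.

Lemma affine_z_presentation : is_presentation [set: B] (affine_z_relation e r) elt.
Proof.
split=> [a|u v]; first split=> // _.
  have Hg := weval_image_subgroup elt; set H := [set b | _] in Hg.
  have HN b : N b -> H b.
    move=> /(affine_subgroupP r_ge3)[w <-]; rewrite -affine_z_elementE.
    by exists [seq (agen_s l.1, l.2) | l <- w].
  apply: (@braid_subgroup e r H) => // [|i|j jr].
  - by exists [:: (agen_z, false)]; rewrite /weval big_seq1.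
  - by apply: HN; apply: affine_subgroup_t.
  - by apply: HN; apply: affine_subgroup_s.
split=> [uv|]; last exact/congruent_weval/affine_z_satisfies.
have [k kE] := affine_z_inverse.
have kw w : k (weval elt w) = weval pg w.
  by rewrite gmulf_weval; apply: eq_bigr => -[x b] _ /=; rewrite kE.
by apply/presented_classP; rewrite -!weval_presented_gen -!kw uv.
Qed.

End AffineZ.

(** * Coset enumeration in G(de,e,r) *)

Section Cosets.

Variables (d e r : nat).
Hypothesis r_ge3 : 2 < r.

Local Notation B := (braid_group e r).
Local Notation z := (braid_z e r).
Local Notation t := (braid_t e r).
Local Notation s := (braid_s e r).
Local Notation bclass := (presented_class (braid_relation e r)).

(* The gradation of the generators for which the words of level at most n give
   the subgroup G(de,e,n) acting on the first n coordinates. *)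
Definition braid_level (x : braid_generator r) : nat :=
  match x with gen_z => 1%N | gen_t _ => 2 | gen_s k => val k end.

Definition parabolic n (w : word (braid_generator r)) : bool :=
  all (fun l => braid_level l.1 <= n) w.

Lemma parabolic_cat n u v : parabolic n (u ++ v) = parabolic n u && parabolic n v.
Proof. exact: all_cat. Qed.

Lemma parabolic_full w : parabolic r w.
Proof.
elim: w => //= -[[|i|k] b] w -> /=; rewrite andbT; try lia.
by case/andP: (valP k).
Qed.

(* With e_1, ..., e_r the row vectors of the standard basis, the image of
   braid_rep n j k in G(de,e,r) maps e_n to zeta^k e_j. *)
Definition braid_rep n j (k : int) : B :=
  desc s 3 (n - 2) *
    (if j == 1%N then t k else t k * t 0%R * (desc s 3 (j - 2))^-1).

Variables (Q : groupType) (q : UMagmaMorphism.type B Q).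
Hypotheses (q_t2 : forall i, q (t i) * q (t i) = 1)
           (q_s2 : forall j, 3 <= j <= r -> q (s j) * q (s j) = 1).

Let T i := q (t i).
Let S j := q (s j).
Let Z := q z.
Let A n := q (desc s 3 (n - 2)).

Let TV i : (T i)^-1 = T i. Proof. exact: involution_inv (q_t2 i). Qed.

Let TS k : T (k + 1)%R = T 1%R * T 0%R * T k.
Proof. by rewrite /T -gmulfM -(braid_ttS e r k) gmulfM -mulgA q_t2 mulg1. Qed.

(** For involutions t_(i+1) t_i = t_1 t_0 is a dihedral relation: a product of two of them depends
    only on the difference of the indices. *)
Let T_mul k m : T (k + m)%R * T m = T k * T 0%R.
Proof.
move: k; apply: (@int_shift_ind _ 0%R) => [|k].
  by rewrite add0r /T !q_t2.
rewrite addrAC !TS -!mulgA; split=> [->//|].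
by do 2 move/mulgI.
Qed.

Let T_mulB k i : T k * T i = T (k - i)%R * T 0%R.
Proof. by rewrite -{1}(subrK i k) T_mul. Qed.

Let T_mulD k i : T k * T 0%R * T i = T (k + i)%R.
Proof. by rewrite -(T_mul k i) -mulgA q_t2 mulg1. Qed.

Let TZ k : T k * Z = Z * T (k + e%:Z)%R.
Proof. by rewrite -!gmulfM braid_zt addrK. Qed.

Let TZV k : T k * Z^-1 = Z^-1 * T (k - e%:Z)%R.
Proof.
apply: (mulgI Z); rewrite mulVKg mulgA; apply: (mulIg Z); rewrite mulgVK.
by rewrite -!gmulfM braid_zt.
Qed.

Let ttZ k : commute (T k * T 0%R) Z.
Proof. by rewrite /commute -mulgA TZ add0r mulgA TZ -mulgA T_mul. Qed.

Let TS_commute k j : 4 <= j <= r -> commute (T k) (S j).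
Proof. by move=> jr; apply/gmulf_commute/commute_sym/braid_st. Qed.

Let ttS_commute k j : 4 <= j <= r -> commute (T k * T 0%R) (S j).
Proof. by move=> jr; apply: commuteMl; apply: TS_commute. Qed.

Let S_artin : artin S 3 r.
Proof.
have [sC sB] := braid_s_artin e r_ge3.
split=> [i j *|i *]; first by apply/gmulf_commute/sC.
by rewrite /braided /S -!gmulfM sB.
Qed.

Let AE n : A n = desc S 3 (n - 2).
Proof. exact: gmulf_prod. Qed.

Let A2 : A 2 = 1.
Proof. by rewrite AE subnn desc0. Qed.

Let AZ n : n <= r -> commute (A n) Z.
Proof.
move=> nr; apply/gmulf_commute/commute_sym/desc_commute => j jr.
apply: braid_zs; lia.
Qed.

Let A_shift n i : 3 <= i -> i < n -> n <= r -> A n * S i.+1 = S i * A n.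
Proof.
move=> i3 n_i nr; rewrite AE; apply: desc_shift; try lia.
by apply: artinW S_artin; lia.
Qed.

Let A_commute n i : n.+1 < i -> i <= r -> commute (S i) (A n).
Proof.
move=> ni ir; rewrite AE; apply: desc_commute => j jn.
by apply: (artin_commute S_artin); lia.
Qed.

Let AS n : 2 <= n -> A n.+1 = S n.+1 * A n.
Proof.
move=> n2; rewrite !AE; have -> : (n.+1 - 2 = (n - 2).+1)%N by lia.
by rewrite descS; congr (S _ * _); lia.
Qed.

Let A3 n : 3 <= n -> A n = desc S 4 (n - 3) * S 3.
Proof.
move=> n3; rewrite AE; have -> : (n - 2 = (n - 3).+1)%N by lia.
exact: descSr.
Qed.

Let TD k n : n <= r -> commute (T k) (desc S 4 (n - 3)).
Proof. by move=> nr; apply: desc_commute => j jn; apply: TS_commute; lia. Qed.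

Let ST k : braided (S 3) (T k).
Proof. by rewrite /braided -!gmulfM braid_s3t. Qed.

(** Only the last factor S 3 of [A n] takes part in the braid relation; the others commute with T
    k. *)
Let ATS3 n k : 3 <= n -> n <= r -> A n * T k * S 3 = T k * (A n * T k).
Proof.
move=> n3 nr; rewrite A3 // -!mulgA [S 3 * (_ * _)]mulgA ST !mulgA.
by rewrite -(TD k nr).
Qed.

Let R n j k := q (braid_rep n j k).

Let RE1 n k : R n 1%N k = A n * T k.
Proof. by rewrite /R /braid_rep gmulfM. Qed.

Let RE n j k : 1 < j -> R n j k = A n * (T k * T 0%R) * (A j)^-1.
Proof.
move=> j1; rewrite /R /braid_rep; have -> : (j == 1%N) = false by lia.
by rewrite !gmulfM gmulfV mulgA.
Qed.

Let RE0 n : 1 < n -> R n n 0%R = 1.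
Proof. by move=> n1; rewrite RE // q_t2 mulg1 mulgV. Qed.

Let in_coset n x := exists w j k,
  [/\ parabolic n.-1 w, 1 <= j <= n & x = q (bclass w) * R n j k].

Let in_coset1 n j k : 1 <= j <= n -> in_coset n (R n j k).
Proof.
by exists [::], j, k; split=> //; rewrite -[bclass _]/(1 : B) gmulf1 mul1g.
Qed.

Let in_cosetM n w x : parabolic n.-1 w -> in_coset n x -> in_coset n (q (bclass w) * x).
Proof.
move=> wn [v [j [k [vn jn ->]]]]; exists (w ++ v), j, k.
by rewrite parabolic_cat wn vn -presented_mulE gmulfM mulgA.
Qed.

Let in_cosetS n i j k : 3 <= i < n -> n <= r -> 1 <= j <= n -> in_coset n (S i * R n j k).
Proof.
move=> i_n nr jn; have [l lE] := @braid_sE e r i ltac:(lia).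
rewrite /S => ->; apply: (@in_cosetM n [:: (gen_s l, false)]); last exact: in_coset1.
by rewrite /= lE; lia.
Qed.

Let in_cosetT n i j k : 3 <= n -> 1 <= j <= n -> in_coset n (T i * R n j k).
Proof.
move=> n3 jn; apply: (@in_cosetM n [:: (gen_t i, false)]); last exact: in_coset1.
by rewrite /=; lia.
Qed.

Let in_cosetZ n j k : 2 <= n -> 1 <= j <= n -> in_coset n (Z * R n j k).
Proof.
move=> n2 jn; apply: (@in_cosetM n [:: (gen_z, false)]); last exact: in_coset1.
by rewrite /=; lia.
Qed.

Let bclassV : bclass [:: (gen_z, true)] = z^-1.
Proof. by rewrite -[RHS]/(presented_inv z) presented_invE. Qed.

Let in_cosetZV n j k : 2 <= n -> 1 <= j <= n -> in_coset n (Z^-1 * R n j k).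
Proof.
move=> n2 jn; rewrite -gmulfV -bclassV; apply: in_cosetM; last exact: in_coset1.
by rewrite /=; lia.
Qed.

Let AVS m : 2 <= m < r -> (A m)^-1 * S m.+1 = (A m.+1)^-1.
Proof.
by move=> mr; rewrite AS ?invgM ?(involution_inv (q_s2 _)) //; lia.
Qed.

Let AVSr m : 2 <= m < r -> (A m.+1)^-1 * S m.+1 = (A m)^-1.
Proof. by move=> mr; rewrite -AVS // -mulgA q_s2 ?mulg1 //; lia. Qed.

(** s_i moves e_j only if i = j or i = j + 1, and then the representative changes. Otherwise the
    letter travels to the left end and arrives there as a generator of level below n. *)
Let coset_s n j k i : n <= r -> 1 <= j <= n -> 3 <= i <= n ->
  in_coset n (R n j k * S i).
Proof.
move=> nr jn i_n; have [->|j1] := eqVneq j 1%N.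
  rewrite RE1; have [->|i3] := eqVneq i 3.
    by rewrite ATS3; try lia; rewrite -RE1; apply: in_cosetT; lia.
  have [m iE] : exists m, i = m.+1 by exists i.-1; lia.
  rewrite iE -mulgA TS_commute; last by lia.
  by rewrite mulgA A_shift; try lia; rewrite -mulgA -RE1; apply: in_cosetS; lia.
rewrite RE; last by lia.
have [ij|ji] := ltnP i j.
  have SA : (A j)^-1 * S i = S i.+1 * (A j)^-1.
    by apply: (mulgI (A j)); rewrite mulVKg !mulgA A_shift ?mulgK //; lia.
  rewrite -mulgA SA mulgA -[A n * _ * _]mulgA ttS_commute; last by lia.
  rewrite [A n * _]mulgA A_shift; try lia.
  rewrite -[S i * A n * _]mulgA -[S i * _ * _]mulgA -RE; last by lia.
  by apply: in_cosetS; lia.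
have [ij|ne_ij] := eqVneq i j.
  have [m jE] : exists m, j = m.+1 by exists j.-1; lia.
  rewrite ij jE -mulgA AVSr; last by lia.
  by rewrite -RE; last lia; apply: in_coset1; lia.
have [ij|ne_ij'] := eqVneq i j.+1.
  rewrite ij -mulgA AVS; last by lia.
  by rewrite -RE; last lia; apply: in_coset1; lia.
have [m iE] : exists m, i = m.+1 by exists i.-1; lia.
have SA : commute (S i) (A j)^-1 by apply/commuteV/A_commute; lia.
rewrite -mulgA -SA mulgA -[A n * _ * _]mulgA ttS_commute; last by lia.
rewrite [A n * _]mulgA iE A_shift; try lia.
rewrite -[S m * A n * _]mulgA -[S m * _ * _]mulgA -RE; last by lia.
by apply: in_cosetS; lia.
Qed.

(** T i exchanges the representatives for j = 1 and j = 2, changing k to k - i or k + i; for j > 2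
    it emerges on the left as T (k + i). *)
Let coset_t n j k i : 2 <= n <= r -> 1 <= j <= n -> in_coset n (R n j k * T i).
Proof.
move=> nr jn; have [->|j1] := eqVneq j 1%N.
  have R2 : R n 1%N k * T i = R n 2 (k - i)%R.
    by rewrite RE1 RE // -mulgA (T_mulB k i) A2 invg1 mulg1.
  by rewrite R2; apply: in_coset1; lia.
have [->|j2] := eqVneq j 2.
  have R1 : R n 2 k * T i = R n 1%N (k + i)%R.
    by rewrite RE1 RE // A2 invg1 mulg1 -mulgA T_mulD.
  by rewrite R1; apply: in_coset1; lia.
suff -> : R n j k * T i = T (k + i)%R * R n j k by apply: in_cosetT; lia.
have SD : (A j)^-1 = S 3 * (desc S 4 (j - 3))^-1.
  by rewrite A3 ?invgM ?(involution_inv (q_s2 _)) //; lia.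
have jr : j <= r by lia.
rewrite RE; last by lia.
(* Splitting T k * T 0 as T (k + i) * T i produces T i * S 3 * T i; after the braid relation [ATS3]
   absorbs the leading S 3. *)
rewrite SD -(T_mul k i) -!mulgA -(commuteV (TD i jr)).
rewrite [T i * (S 3 * (T i * _))]mulgA [T i * S 3 * _]mulgA -ST !mulgA ATS3; try lia.
by rewrite !mulgA.
Qed.

Let coset_z n j k : 2 <= n <= r -> 1 <= j <= n -> in_coset n (R n j k * Z).
Proof.
move=> nr jn; have [->|j1] := eqVneq j 1%N.
  rewrite RE1 -mulgA TZ mulgA AZ; last by lia.
  by rewrite -mulgA -RE1; apply: in_cosetZ; lia.
suff -> : R n j k * Z = Z * R n j k by apply: in_cosetZ; lia.
rewrite RE; last by lia.
apply: commuteMl; last by apply/commute_sym/commuteV/commute_sym/AZ; lia.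
by apply: commuteMl; [apply: AZ; lia | apply: ttZ].
Qed.

Let coset_zV n j k : 2 <= n <= r -> 1 <= j <= n -> in_coset n (R n j k * Z^-1).
Proof.
move=> nr jn; have [->|j1] := eqVneq j 1%N.
  rewrite RE1 -mulgA TZV mulgA (commuteV (AZ _)); last by lia.
  by rewrite -mulgA -RE1; apply: in_cosetZV; lia.
suff -> : R n j k * Z^-1 = Z^-1 * R n j k by apply: in_cosetZV; lia.
rewrite RE; last by lia.
apply: commuteMl; last by apply/commuteV/commute_sym/commuteV/commute_sym/AZ; lia.
by apply: commuteMl; apply: commuteV; [apply: AZ; lia | apply: ttZ].
Qed.

(** Representatives are multiplied on the right by one letter at a time. The morphism [q] is left
    general because the target will be the abstractly presented group, whose faithfulness is at
    stake. *)
Lemma parabolic_coset n w : 2 <= n <= r -> parabolic n w ->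
  exists w' j k, [/\ parabolic n.-1 w', 1 <= j <= n
                   & q (bclass w) = q (bclass w') * q (braid_rep n j k)].
Proof.
move=> nr; rewrite -/(in_coset n _).
elim/last_ind: w => [_|w [x b] IHw].
  by rewrite -[bclass _]/(1 : B) gmulf1 -(@RE0 n); [apply: in_coset1|]; lia.
rewrite /parabolic all_rcons => /andP[xn /IHw[w' [j [k [w'n jn wE]]]]].
rewrite -cats1 -presented_mulE gmulfM wE -mulgA; apply: in_cosetM => //.
rewrite -/(R n j k); case: x xn => [|i|l] /= xn.
- by case: b; [rewrite bclassV gmulfV; apply: coset_zV | apply: coset_z].
- suff -> : q (bclass [:: (gen_t i, b)]) = T i by apply: coset_t.
  case: b => //; have -> : bclass [:: (gen_t i, true)] = (t i)^-1.
    by rewrite -[RHS]/(presented_inv (t i)) presented_invE.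
  by rewrite gmulfV TV.
- have lr : 3 <= val l <= r := valP l; suff -> : q (bclass [:: (gen_s l, b)]) = S (val l).
    by apply: coset_s => //; move: lr (xn : val l <= n); lia.
  rewrite /S -braid_gen_s; case: b => //.
  have -> : bclass [:: (gen_s l, true)] = (presented_gen (braid_relation e r) (gen_s l))^-1.
    by rewrite -[RHS]/(presented_inv (presented_gen _ _)) presented_invE.
  by rewrite gmulfV braid_gen_s involution_inv // q_s2.
Qed.

Hypothesis q_zd : q z ^+ d = 1.

(** Conjugation by z^d shifts the index by de, and z^d is trivial in [Q]. *)
Lemma braid_t_period k m : q (t (k + (d * e * m)%N%:Z)%R) = q (t k).
Proof.
elim: m k => [|m IHm] k; first by rewrite muln0 addr0.
rewrite mulnS PoszD addrA IHm -/(T _) -/(T _).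
have TZX i n : T i * Z ^+ n = Z ^+ n * T (i + (n * e)%N%:Z)%R.
  elim: n i => [|n IHn] i; first by rewrite mul0n addr0 mul1g mulg1.
  by rewrite expgS mulgA TZ -!mulgA IHn -addrA mulSn PoszD.
by have := TZX k d; rewrite q_zd mul1g mulg1.
Qed.

Lemma braid_rep_period n k : 1 < n -> q (t k) = q (t 0%R) -> q (braid_rep n n k) = 1.
Proof.
by move=> n1 tk; rewrite -/(R n n k) RE // /T tk q_t2 mulg1 mulgV.
Qed.

End Cosets.

(** * Monomial matrices *)

Ltac nat_eq_cases :=
  repeat match goal with |- context [@eq_op _ ?a ?b] => case: (a =P b) => /= end;
  move=> *; lia.

Section Matrices.

Local Open Scope ring_scope.

Variables (C : fieldType) (d e r : nat) (zeta : C).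
Hypothesis r_ge3 : (2 < r)%N.
Hypothesis zeta_prim : (d * e)%N.-primitive_root zeta.

Local Notation Gr := (imprimitive_group C d e r).

Lemma zeta_neq0 : zeta != 0.
Proof.
apply/eqP=> z0; have := prim_expr_order zeta_prim.
rewrite z0 expr0n; have := prim_order_gt0 zeta_prim; case: (_ * _)%N => // n _ /eqP.
by rewrite eq_sym oner_eq0.
Qed.

(** Numbered from 0, so [eps a] is e_(a+1). Row vectors are acted on from the right, so words act
    letter by letter from left to right. *)
Definition eps (a : nat) : 'rV[C]_r := \row_j (j == a :> nat)%:R.

Definition swap (m a : nat) : nat :=
  if a == m then m.+1 else if a == m.+1 then m else a.

Lemma eps_scale_eq a b (c : C) : (a < r)%N -> (b < r)%N ->
  c *: eps a = eps b -> a = b /\ c = 1.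
Proof.
move=> ar br /rowP ab; have := ab (Ordinal br); rewrite !mxE /= eqxx.
case: eqP => [ba|_]; last by rewrite mulr0 => /eqP; rewrite eq_sym oner_eq0.
by rewrite mulr1.
Qed.

Lemma eps_mul (a : 'I_r) (M : 'M[C]_r) : eps a *m M = row a M.
Proof.
rewrite rowE; congr (_ *m _); apply/rowP => j; rewrite !mxE eqxx /=.
by congr (_%:R); rewrite -val_eqE.
Qed.

Lemma eps_inj (M M' : 'M[C]_r) :
  (forall a, (a < r)%N -> eps a *m M = eps a *m M') -> M = M'.
Proof. by move=> MM; apply/row_matrixP => a; rewrite -!eps_mul MM. Qed.

Definition mono_coef (x : braid_generator r) (a : nat) : C :=
  match x with
  | gen_z => if a == 0%N then zeta ^+ e else 1
  | gen_t i => if a == 0%N then zeta ^ (- i) else if a == 1%N then zeta ^ i else 1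
  | gen_s _ => 1
  end.

Definition mono_move (x : braid_generator r) (a : nat) : nat :=
  match x with
  | gen_z => a
  | gen_t _ => swap 0 a
  | gen_s k => swap (val k - 2) a
  end.

Definition gen_matrix (x : braid_generator r) : 'M[C]_r :=
  \matrix_(a, b) (mono_coef x a *+ (b == mono_move x a :> nat)).

Lemma gen_matrix_eps x a : (a < r)%N ->
  eps a *m gen_matrix x = mono_coef x a *: eps (mono_move x a).
Proof.
move=> ar; rewrite (eps_mul (Ordinal ar)); apply/rowP => j; rewrite !mxE /=.
by rewrite mulr_natr.
Qed.

Lemma swap_lt m a : (m.+1 < r)%N -> (a < r)%N -> (swap m a < r)%N.
Proof. by rewrite /swap; nat_eq_cases. Qed.

Lemma swapK m : involutive (swap m).
Proof. by move=> a; rewrite /swap; nat_eq_cases. Qed.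

Lemma mono_move_lt x a : (a < r)%N -> (mono_move x a < r)%N.
Proof.
by move=> ar; case: x => [|i|[k kr]] //=; apply: swap_lt => //; lia.
Qed.

Lemma mono_move_inj x : injective (mono_move x).
Proof. by case: x => [|i|k] //=; apply: inv_inj; apply: swapK. Qed.

Lemma gen_matrix_imprimitive x : in_imprimitive d e (gen_matrix x).
Proof.
pose p (a : 'I_r) : 'I_r := Ordinal (mono_move_lt x (ltn_ord a)).
have p_inj : injective p by move=> a b /(congr1 val)/mono_move_inj/val_inj.
have zu : zeta ^+ (d * e) = 1 := prim_expr_order zeta_prim.
have r0 : (0 < r)%N by lia.
have r1 : (1 < r)%N by lia.
apply/in_imprimitiveP; exists (perm p_inj), (fun a => mono_coef x a); split.
- apply/matrixP => a b; rewrite !mxE permE; congr (_ *+ _).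
  by rewrite eq_sym -val_eqE.
- have z0 := zeta_neq0; move=> a; case: x {p p_inj} => [|i|k] /=; last exact: oner_neq0.
    by case: ifP => _; rewrite ?oner_neq0 // expf_neq0.
  by do 2 (case: ifP => _; first by rewrite expfz_neq0); exact: oner_neq0.
- move=> a; case: x {p p_inj} => [|i|k] /=; last exact: expr1n.
    by case: ifP => _; rewrite ?expr1n // exprAC zu expr1n.
  have zi l : (zeta ^ l) ^+ (d * e) = 1.
    by rewrite exprnP exprz_exp mulrC -exprz_exp -exprnP zu exp1rz.
  by do 2 (case: ifP => _; first exact: zi); exact: expr1n.
- case: x {p p_inj} => [|i|k] /=.
  + rewrite (bigD1 (Ordinal r0)) //= big1 => [|a a0].
      by rewrite mulr1 -exprM mulnC zu.
    by case: eqP => // /eqP; rewrite -val_eqE /= in a0 *; rewrite (negbTE a0).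
  + rewrite (bigD1 (Ordinal r0)) //= (bigD1 (Ordinal r1)) //= big1 => [|a].
      by rewrite mulr1 -expfzDr ?zeta_neq0 // addNr expr1n.
    by rewrite -!val_eqE /= => /andP[/negbTE-> /negbTE->].
  + by rewrite big1 // expr1n.
Qed.

Definition gen_imprimitive (x : braid_generator r) : Gr :=
  Sub (gen_matrix x) (gen_matrix_imprimitive x).

Lemma val_mulg (M M' : Gr) : val (M * M')%g = val M *m val M'.
Proof. by []. Qed.


Lemma gen_imprimitive_eps x a : (a < r)%N ->
  eps a *m val (gen_imprimitive x) = mono_coef x a *: eps (mono_move x a).
Proof. exact: gen_matrix_eps. Qed.

Lemma gen_mul2 x y a : (a < r)%N ->
  eps a *m val (gen_imprimitive x * gen_imprimitive y)%g =
  (mono_coef x a * mono_coef y (mono_move x a)) *: eps (mono_move y (mono_move x a)).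
Proof.
move=> ar; rewrite val_mulg mulmxA gen_imprimitive_eps // -scalemxAl.
by rewrite gen_imprimitive_eps ?mono_move_lt // scalerA.
Qed.

Lemma gen_mul3 x y w a : (a < r)%N ->
  eps a *m val (gen_imprimitive x * gen_imprimitive y * gen_imprimitive w)%g =
  (mono_coef x a * mono_coef y (mono_move x a) *
     mono_coef w (mono_move y (mono_move x a))) *:
  eps (mono_move w (mono_move y (mono_move x a))).
Proof.
move=> ar; rewrite val_mulg mulmxA gen_mul2 // -scalemxAl.
by rewrite gen_imprimitive_eps ?mono_move_lt // scalerA.
Qed.

Lemma imprimitive_inj (M M' : Gr) :
  (forall a, (a < r)%N -> eps a *m val M = eps a *m val M') -> M = M'.
Proof. by move=> MM; apply/val_inj/eps_inj. Qed.

Lemma gen_imprimitive_satisfies : satisfies gen_imprimitive (braid_relation e r).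
Proof.
have zX (i j : int) : zeta ^ i * zeta ^ j = zeta ^ (i + j).
  by rewrite expfzDr // zeta_neq0.
move=> _ _ [[i ir] [j jr] ij|[i ir] [j jr] ij|i j|[k kr] i k3|[j jr] i j4|i|[j jr]];
  rewrite ?big_seq2 ?big_seq3; apply: imprimitive_inj => a ar;
  rewrite ?gen_mul2 ?gen_mul3 //=.
- by congr (_ *: eps _); move: ij; rewrite /swap /= => ij; nat_eq_cases.
- by congr (_ *: eps _); move: ij; rewrite /swap /= => ij; nat_eq_cases.
- case: a ar => [|[|a]] ar; rewrite /swap /= ?mulr1 // !zX; congr (zeta ^ _ *: _); lia.
- rewrite /= in k3; rewrite k3; case: a ar => [|[|[|a]]] ar; rewrite /swap /= ?mulr1 ?mul1r //.
  by rewrite zX subrr.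
- rewrite /= in j4; have m2 : (2 <= j - 2)%N by lia.
  move: (j - 2)%N m2 => m m2; case: a ar => [|[|a]] ar.
  + have E0 : swap m 0 = 0%N by rewrite /swap; nat_eq_cases.
    have E1 : swap m 1 = 1%N by rewrite /swap; nat_eq_cases.
    by rewrite E0 /= E1 mulr1 mul1r.
  + have E0 : swap m 0 = 0%N by rewrite /swap; nat_eq_cases.
    have E1 : swap m 1 = 1%N by rewrite /swap; nat_eq_cases.
    by rewrite E1 /= E0 mulr1 mul1r.
  + have [b ->] : exists b, swap m a.+2 = b.+2; last by rewrite mulr1.
    by exists (swap m a.+2 - 2)%N; rewrite /swap; nat_eq_cases.
- case: a ar => [|[|a]] ar; rewrite /swap /= ?mulr1 ?mul1r // exprnP zX;
  congr (zeta ^ _ *: _); lia.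
- have m1 : (1 <= j - 2)%N by lia.
  move: (j - 2)%N m1 => m m1; case: a ar => [|a] ar.
  + have E0 : swap m 0 = 0%N by rewrite /swap; nat_eq_cases.
    by rewrite E0 mulr1 mul1r.
  + have [b ->] : exists b, swap m a.+1 = b.+1; last by rewrite mulr1.
    by exists (swap m a.+1 - 1)%N; rewrite /swap; nat_eq_cases.
Qed.

Definition braid_matrix : UMagmaMorphism.type (braid_group e r) Gr :=
  presented_map gen_imprimitive_satisfies.

Local Notation f := braid_matrix.
Local Notation z := (braid_z e r).
Local Notation t := (braid_t e r).
Local Notation s := (braid_s e r).

Lemma braid_matrix_gen x : f (presented_gen (braid_relation e r) x) = gen_imprimitive x.
Proof. exact: (presented_map_gen gen_imprimitive_satisfies x). Qed.

Lemma braid_matrix_eps_z a : (a < r)%N ->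
  eps a *m val (f z) = (if a == 0%N then zeta ^+ e else 1) *: eps a.
Proof. by move=> ar; rewrite braid_matrix_gen gen_imprimitive_eps. Qed.

Lemma braid_matrix_eps_t i a : (a < r)%N ->
  eps a *m val (f (t i)) = mono_coef (gen_t i) a *: eps (swap 0 a).
Proof. by move=> ar; rewrite braid_matrix_gen gen_imprimitive_eps. Qed.

Lemma braid_matrix_eps_s j a : (3 <= j <= r)%N -> (a < r)%N ->
  eps a *m val (f (s j)) = eps (swap (j - 2) a).
Proof.
move=> /(@braid_sE e)[k <- ->] ar.
by rewrite braid_matrix_gen gen_imprimitive_eps // scale1r.
Qed.

Lemma braid_matrix_z : val (f z) = z_matrix e r zeta.
Proof.
apply: eps_inj => a ar; rewrite braid_matrix_eps_z //.
rewrite (eps_mul (Ordinal ar)); apply/rowP => j; rewrite !mxE /=.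
by rewrite -[RHS]mulr_natr -val_eqE /= (eq_sym a j).
Qed.

Lemma braid_matrix_t i : val (f (t i)) = t_matrix r zeta i.
Proof.
apply: eps_inj => a ar; rewrite braid_matrix_eps_t //.
rewrite (eps_mul (Ordinal ar)); apply/rowP => j; rewrite !mxE /= -val_eqE /=.
by case: a ar => [|[|a]] ar; case: (nat_of_ord j) => [|[|b]];
  rewrite /swap /= ?mulr0 ?mulr1 ?mul1r // eq_sym.
Qed.

Lemma braid_matrix_s j (a b : 'I_r) : (3 <= j <= r)%N ->
  a = (j - 2)%N :> nat -> b = (j - 1)%N :> nat -> val (f (s j)) = tperm_mx a b.
Proof.
move=> jr aE bE; apply: eps_inj => c cr; rewrite braid_matrix_eps_s //.
rewrite (eps_mul (Ordinal cr)); apply/rowP => k; rewrite !mxE -val_eqE eq_sym.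
congr (_%:R : C); congr (nat_of_bool (_ == _)); rewrite /swap.
case: tpermP => [/(congr1 val)/= ->|/(congr1 val)/= ->|/eqP ca /eqP cb] /=.
- by rewrite aE eqxx bE; lia.
- by rewrite bE aE; nat_eq_cases.
- by rewrite -!val_eqE /= in ca cb; nat_eq_cases.
Qed.

Lemma act_inv (M : Gr) (v v' : 'rV[C]_r) :
  v *m val M = v' -> v' *m val (M^-1)%g = v.
Proof.
by move=> <-; rewrite -mulmxA -val_mulg mulgV mulmx1.
Qed.

Lemma eps_desc n : (2 <= n <= r)%N ->
  eps n.-1 *m val (f (desc s 3 (n - 2))) = eps 1.
Proof.
elim: n => // n IHn nr; have [->|n1] := eqVneq n 1%N.
  by rewrite desc0 gmulf1 mulmx1.
have -> : (n.+1 - 2 = (n - 2).+1)%N by lia.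
rewrite descS gmulfM val_mulg mulmxA braid_matrix_eps_s; try lia.
rewrite -IHn; last by lia.
by congr (eps _ *m _); rewrite /swap; nat_eq_cases.
Qed.

(** The successive factors move e_n to e_2, then to zeta^k e_1, and for j > 1 on to zeta^k e_2 and
    zeta^k e_j. *)
Lemma braid_rep_eps n j k : (2 <= n <= r)%N -> (1 <= j <= n)%N ->
  eps n.-1 *m val (f (braid_rep e r n j k)) = zeta ^ k *: eps j.-1.
Proof.
move=> nr jn; rewrite /braid_rep gmulfM val_mulg mulmxA eps_desc //.
have r1 : (1 < r)%N by lia.
case: eqP => [->|j1]; first by rewrite braid_matrix_eps_t.
rewrite !gmulfM !val_mulg !mulmxA braid_matrix_eps_t //= -!scalemxAl.
have s01 : swap 0 1 = 0%N by [].
rewrite s01 braid_matrix_eps_t /=; last by lia.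
rewrite scale1r; congr (_ *: _); rewrite gmulfV; apply: act_inv.
by apply: eps_desc; lia.
Qed.

Lemma eps_fix_subgroup a :
  is_subgroup [set b : braid_group e r | eps a *m val (f b) = eps a].
Proof.
split=> [|b c /= bE cE|b /= bE]; first by rewrite /= gmulf1 mulmx1.
  by rewrite gmulfM val_mulg mulmxA bE cE.
by rewrite gmulfV; apply: act_inv.
Qed.

Lemma gen_fix x a : (braid_level x <= a)%N -> (a < r)%N ->
  eps a *m val (f (presented_gen (braid_relation e r) x)) = eps a.
Proof.
move=> xa ar; rewrite braid_matrix_gen gen_imprimitive_eps //.
case: x xa => [|i|[k kr]] /= xa; rewrite /swap.
- by case: eqP => [|_]; [lia|rewrite scale1r].
- by case: a xa ar => [|[|a]] //= _ _; rewrite scale1r.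
- by rewrite scale1r; congr eps; nat_eq_cases.
Qed.

Lemma parabolic_fix n w a : parabolic n w -> (n <= a)%N -> (a < r)%N ->
  eps a *m val (f (presented_class (braid_relation e r) w)) = eps a.
Proof.
move=> wn na ar; have [H1 HM HV] := eps_fix_subgroup a.
rewrite -weval_presented_gen; elim: w wn => [|[x b] w IHw] /=.
  by rewrite weval_nil => _; apply: H1.
move=> /andP[xn /IHw IH]; rewrite /weval big_cons; apply: HM => //.
have fx := @gen_fix x a (leq_trans xn na) ar.
by case: b => //=; apply: HV.
Qed.

Lemma braid_rep_fix n j k a : (2 <= n <= r)%N -> (1 <= j <= n)%N ->
  (n <= a)%N -> (a < r)%N -> eps a *m val (f (braid_rep e r n j k)) = eps a.
Proof.
move=> nr jn na ar; have Hg := eps_fix_subgroup a; have [H1 HM HV] := Hg.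
have Ht i : eps a *m val (f (t i)) = eps a by apply: gen_fix => //=; lia.
have HD m : (m <= n)%N -> eps a *m val (f (desc s 3 (m - 2))) = eps a.
  move=> mn; apply: (subgroup_prod Hg) => l; rewrite mem_rev mem_iota => lm.
  have [k' kE] := @braid_sE e r l ltac:(lia).
  by rewrite /= => ->; apply: gen_fix => //=; rewrite kE; lia.
apply: (HM); first exact: HD.
case: eqP => _; first exact: Ht.
by apply: (HM); [apply: HM; apply: Ht | apply: HV; apply: HD; lia].
Qed.

Lemma braid_matrix_t2 i : (f (t i) * f (t i) = 1)%g.
Proof.
apply: imprimitive_inj => a ar; rewrite braid_matrix_gen gen_mul2 // mulmx1 /= swapK.
case: a ar => [|[|a]] ar; rewrite /swap /= ?mulr1 ?scale1r //;
  by rewrite -expfzDr ?zeta_neq0 // ?subrr ?addNr ?scale1r.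
Qed.

Lemma braid_matrix_eps_zX n a : (a < r)%N ->
  eps a *m val (f (z ^+ n)%g) = (if a == 0%N then zeta ^+ (e * n) else 1) *: eps a.
Proof.
move=> ar; elim: n => [|n IHn].
  by rewrite gmulf1 mulmx1 muln0; case: ifP; rewrite scale1r.
rewrite expgS gmulfM val_mulg mulmxA braid_matrix_eps_z // -scalemxAl IHn scalerA.
by case: ifP => _; rewrite ?mulr1 // mulnS exprD.
Qed.

Lemma braid_matrix_zd : (f z ^+ d = 1)%g.
Proof.
apply: imprimitive_inj => a ar; rewrite -gmulfXn braid_matrix_eps_zX // mulmx1.
by rewrite mulnC (prim_expr_order zeta_prim) if_same scale1r.
Qed.

End Matrices.

(** * Reflections as rank-one perturbations of the identity *)

Section Reflections.

Local Open Scope ring_scope.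

Variables (C : fieldType) (r : nat).

(** The kernel of [w] is the fixed hyperplane. Unlike a dimension count, this form is easily carried
    through conjugation. *)
Definition elementary (M : 'M[C]_r) : Prop :=
  exists (u : 'cV[C]_r) (w : 'rV[C]_r), [/\ u != 0, w != 0 & M = 1%:M + u *m w].

Lemma elementary_reflection M : elementary M -> is_reflection M.
Proof.
move=> [u [w [u0 w0 ->]]]; split.
  have /matrix0Pn[i [k ui]] := u0; have /matrix0Pn[k' [j wj]] := w0.
  apply/eqP => /matrixP/(_ i j); rewrite !mxE big_ord1 -[RHS]addr0 => /addrI/eqP.
  by rewrite mulf_eq0 !(ord1 _) in ui wj *; rewrite (negbTE ui) (negbTE wj).
have wlin : linear (mulmx w : 'cV[C]_r -> 'M[C]_1) by move=> a x y; rewrite linearP.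
pose phi : 'Hom('cV[C]_r, 'M[C]_1) := linfun (mulmx w).
exists (lker phi); split; last first.
  move=> v; rewrite memv_ker lfunE /= => /eqP wv.
  by rewrite mulmxDl mul1mx -mulmxA wv mulmx0 addr0.
have rE : (\dim (lker phi) + \dim (limg phi))%N = r.
  by have := limg_ker_dim phi fullv; rewrite capfv dimvf => ->; exact: muln1.
suff phi1 : \dim (limg phi) = 1%N by rewrite -[in RHS]rE phi1 addnK.
apply/eqP; rewrite eqn_leq; apply/andP; split.
  by have := dimvS (subvf (limg phi)); rewrite dimvf dim_matrix.
rewrite lt0n dimv_eq0; apply/eqP => phi0.
have /matrix0Pn[k [j wj]] := w0.
have : phi (delta_mx j 0) \in limg phi by apply: memv_img (memvf _).
rewrite phi0 memv0 lfunE /= -colE => /eqP/matrixP/(_ k 0)/eqP.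
by rewrite !mxE (negbTE wj).
Qed.

Lemma elementary_conj (M P P' : 'M[C]_r) : P' *m P = 1%:M ->
  elementary M -> elementary (P' *m (M *m P)).
Proof.
move=> PP [u [w [u0 w0 ->]]]; have PP' := mulmx1C PP.
exists (P' *m u), (w *m P); split.
- by apply: contra u0 => /eqP Pu; rewrite -[u]mul1mx -PP' -mulmxA Pu mulmx0.
- by apply: contra w0 => /eqP wP; rewrite -[w]mulmx1 -PP' mulmxA wP mul0mx.
- by rewrite mulmxDl mul1mx mulmxDr PP !mulmxA.
Qed.

End Reflections.

(** * Kernel and image of the matrix morphism *)

Lemma expg_modn (G : groupType) (x : G) d m : x ^+ d = 1 -> x ^+ (m %% d) = x ^+ m.
Proof.
by move=> xd; rewrite [in RHS](divn_eq m d) expgnDr mulnC expgnA xd expg1n mul1g.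
Qed.

Section ReflectionGroup.

Variables (C : fieldType) (d e r : nat) (zeta : C).
Hypotheses (d_gt1 : 1 < d) (e_gt0 : 0 < e) (r_ge3 : 2 < r).
Hypothesis zeta_prim : ((d * e)%N.-primitive_root zeta)%R.

Local Notation B := (braid_group e r).
Local Notation Gr := (imprimitive_group C d e r).
Local Notation f := (braid_matrix r_ge3 zeta_prim).
Local Notation z := (braid_z e r).
Local Notation t := (braid_t e r).
Local Notation s := (braid_s e r).
Local Notation sg := (braid_affine_generator e r).
Local Notation elt := (affine_z_element e r).
Local Notation eps := (eps C r).
Local Notation bclass := (presented_class (braid_relation e r)).

Lemma zeta_expz1 (k : int) : (zeta ^ k = 1)%R ->
  exists m, k = (d * e * m)%N \/ k = (- (d * e * m)%N%:Z)%R.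
Proof.
have zX n : (zeta ^+ n = 1)%R -> exists m, n = (d * e * m)%N.
  move/eqP; rewrite -(prim_order_dvd zeta_prim) => /dvdnP[m ->].
  by exists m; rewrite mulnC.
case: k => n; first by move=> /zX[m ->]; exists m; left.
move=> zn; have /eqP : (zeta ^- n.+1 = 1)%R := zn.
by rewrite invr_eq1 => /eqP/zX[m nm]; exists m; right; rewrite NegzE nm.
Qed.

Section Kernel.

Variables (Q : groupType) (q : UMagmaMorphism.type B Q).
Hypotheses (q_t2 : forall i, q (t i) * q (t i) = 1)
           (q_s2 : forall j, 3 <= j <= r -> q (s j) * q (s j) = 1)
           (q_zd : q z ^+ d = 1)
           (q_f : forall a b, q a = q b -> f a = f b).

(** z^m z^-n multiplies e_1 by zeta^(e(m-n)), and zeta has order de, so m = n modulo d. *)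
Lemma kernel_z w : parabolic 1 w -> f (bclass w) = 1 -> q (bclass w) = 1.
Proof.
move=> w1; have [m [n ->]] : exists m n, bclass w = z ^+ m * z ^- n.
  apply: generated_zP; have Kg := subgroup_generated_subgroup [set z].
  have [K1 KM KV] := Kg; rewrite -weval_presented_gen.
  have zK : subgroup_generated [set z] z by apply: mem_subgroup_generated.
  elim: w w1 => [|[[|i|[k kr]] b] w IHw] /=; rewrite ?weval_nil //; last by lia.
  move=> w1; rewrite /weval big_cons; apply: (KM); last exact: IHw.
  by case: b => //; apply: KV.
move=> fz; have {fz} fE : f (z ^+ m) = f (z ^+ n).
  by apply: divg1_eq; rewrite -gmulfV -gmulfM.
have r0 : 0 < r by lia.
have : (eps 0 *m val (f (z ^+ m)%g) = eps 0 *m val (f (z ^+ n)%g))%R by rewrite fE.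
rewrite !braid_matrix_eps_zX //= => zE.
have {zE} /eqP : (zeta ^+ (e * m) = zeta ^+ (e * n))%R.
  move/rowP/(_ (Ordinal r0)): zE; rewrite !mxE /= !mulr1; exact.
rewrite (eq_prim_root_expr zeta_prim) (mulnC d) -!muln_modr.
rewrite eqn_pmul2l // => /eqP mn.
by rewrite gmulfM gmulfV !gmulfXn -(expg_modn m q_zd) mn (expg_modn n q_zd) mulgV.
Qed.

Lemma kernel_parabolic n w : 1 <= n <= r -> parabolic n w ->
  f (bclass w) = 1 -> q (bclass w) = 1.
Proof.
elim: n w => // n IHn w nr; have [->|n0] := eqVneq n 0; first exact: kernel_z.
have n2 : 2 <= n.+1 <= r by lia.
move=> /(parabolic_coset r_ge3 q_t2 q_s2 n2)[w' [j [k [w'n jn wE]]]] fw.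
(* The factorization holds only in [Q]; [q_f] carries it over to matrices. *)
have fE : f (bclass w') * f (braid_rep e r n.+1 j k) = 1.
  by rewrite -gmulfM -fw; apply/q_f; rewrite gmulfM.
have : (eps n *m val (f (bclass w') * f (braid_rep e r n.+1 j k))%g = eps n)%R.
  by rewrite fE mulmx1.
have w'fix : (eps n *m val (f (bclass w')) = eps n)%R.
  by apply: (parabolic_fix _ _ w'n) => /=; lia.
rewrite val_mulg mulmxA w'fix.
rewrite (@braid_rep_eps _ _ _ _ _ r_ge3 zeta_prim n.+1) // => /eps_scale_eq[||jE zk]; try lia.
have jE' : j = n.+1 by lia.
rewrite {}jE' in jn wE fE *.
have R1 : q (braid_rep e r n.+1 n.+1 k) = 1.
  apply: braid_rep_period => //; first by lia.
  (* zeta^k = 1 makes k a multiple of de, of either sign, so t_k and t_0 agree in [Q]. *)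
  have [m [->|->]] := zeta_expz1 zk.
    by rewrite -[Posz _]add0r; apply: braid_t_period.
  by rewrite -[LHS](braid_t_period q_zd _ m) addNr.
rewrite wE R1 mulg1; apply: IHn => //; first by lia.
rewrite -fw; apply: q_f; rewrite wE R1 mulg1 //.
Qed.

Lemma kernel_trivial a : f a = 1 -> q a = 1.
Proof.
rewrite -(presented_reprK a); apply: (@kernel_parabolic r); first by lia.
exact: parabolic_full.
Qed.

End Kernel.

Lemma imprimitive_eps (M : Gr) a : a < r ->
  exists c b, [/\ b < r, (c ^+ (d * e) = 1)%R & (eps a *m val M = c *: eps b)%R].
Proof.
move=> ar; have /in_imprimitiveP[p [c [ME _ cde _]]] := valP M.
exists (c (Ordinal ar)), (p (Ordinal ar)); split=> //.
rewrite ME (eps_mul (Ordinal ar)); apply/rowP => j; rewrite !mxE mulr_natr.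
by rewrite eq_sym val_eqE.
Qed.

Lemma braid_matrix_surj n (M : Gr) : 1 <= n <= r ->
  (forall a, n <= a -> a < r -> (eps a *m val M = eps a)%R) ->
  exists b, f b = M.
Proof.
have r0 : 0 < r by lia.
elim: n M => // n IHn M nr Mfix; have [n0|n0] := eqVneq n 0.
  rewrite {}n0 in Mfix; have /in_imprimitiveP[p [c [ME _ _ cd]]] := valP M.
  have rowE a : (eps (val a) *m val M = c a *: eps (val (p a)))%R.
    rewrite ME eps_mul; apply/rowP => j; rewrite !mxE mulr_natr.
    by rewrite eq_sym val_eqE.
  have pc a : a != Ordinal r0 -> p a = a /\ c a = 1%R.
    rewrite -val_eqE /= => a0; have := Mfix a; rewrite rowE => /(_ ltac:(lia) (ltn_ord a)) pa.
    by have [/val_inj] := eps_scale_eq (ltn_ord (p a)) (ltn_ord a) pa.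
  have p0 : p (Ordinal r0) = Ordinal r0.
    apply/eqP/negPn/negP => ne; have [pp _] := pc _ ne.
    by move/perm_inj: pp => pp; rewrite pp eqxx in ne.
  (* At the bottom [M] is diagonal with a single free entry; the condition on the product makes it a
     d-th root of unity, hence a power of zeta^e. *)
  have c0 : (c (Ordinal r0) ^+ d = 1)%R.
    by move: cd; rewrite (bigD1 (Ordinal r0)) //= big1 ?mulr1 // => a /pc[].
  have ze : (d.-primitive_root (zeta ^+ e))%R.
    have := exp_prim_root zeta_prim e.
    by rewrite gcdnMl mulnK.
  have [m cE] := prim_rootP ze c0.
  exists (z ^+ m); apply: imprimitive_inj => a ar.
  rewrite braid_matrix_eps_zX // (rowE (Ordinal ar)).
  have [a0|a0] := eqVneq (Ordinal ar) (Ordinal r0).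
    have a00 : a = 0 := congr1 val a0.
    by rewrite a0 p0 cE a00 exprM.
  have [-> ->] := pc _ a0; rewrite -val_eqE /= in a0; by rewrite (negbTE a0).
have [c [j [jr cde ME]]] := imprimitive_eps M (a := n) ltac:(lia).
(* If j > n, then [M] fixes [eps j], so by invertibility [eps n] would be a multiple of [eps j]. *)
have jn : j <= n.
  rewrite leqNgt; apply/negP => nj.
  have nE : (c *: eps j = eps n)%R.
    by rewrite -(act_inv ME) -scalemxAl (act_inv (Mfix j nj jr)).
  by have [||nj'] := eps_scale_eq _ _ nE; lia.
have [k cE] := prim_rootP zeta_prim cde.
pose R := f (braid_rep e r n.+1 j.+1 k%:Z).
have RE : (eps n *m val R = eps n *m val M)%R.
  rewrite ME cE; apply: (@braid_rep_eps _ _ _ _ _ r_ge3 zeta_prim n.+1); lia.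
have [|a na ar|b bE] := IHn (M * R^-1); first by lia.
  rewrite val_mulg mulmxA; have [->|ne] := eqVneq a n.
    exact: act_inv RE.
  rewrite Mfix //; last by lia.
  by apply: act_inv; apply: braid_rep_fix => //; lia.
by exists (b * braid_rep e r n.+1 j.+1 k%:Z); rewrite gmulfM bE mulgVK.
Qed.

End ReflectionGroup.

(** * The presentation of G(de,e,r) and its reflections *)

Lemma affine_z_universal (e r : nat) (G : groupType) (g : affine_z_generator r -> G) :
  2 < r -> 0 < e -> satisfies g (affine_z_relation e r) ->
  exists q : UMagmaMorphism.type (braid_group e r) G,
    forall x, q (affine_z_element e r x) = g x.
Proof.
move=> r3 e0 gP; have [k kE] := affine_z_inverse r3 e0.
exists (presented_map gP \o k : UMagmaMorphism.type _ _) => x.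
by rewrite /= kE; apply: (presented_map_gen gP).
Qed.

Lemma prod_nseq (G : groupType) (X : Type) (g : X -> G) n x :
  \prod_(y <- nseq n x) g y = g x ^+ n.
Proof. by elim: n => [|n IHn]; rewrite ?big_nil //= big_cons IHn expgS. Qed.

(** Braided elements are conjugate. Thus s_3^2 = 1 makes every t_i an involution, and t_0^2 = 1 does
    so for all s_i. *)
Lemma braided_involution (G : groupType) (x y : G) :
  braided x y -> x * x = 1 -> y * y = 1.
Proof.
move=> /braided_conjE xy xx; apply: (@conjg_inj _ x).
by rewrite conj1g conjMg -xy -conjMg xx conj1g.
Qed.

Section ReflectionPresentation.

Variables (C : fieldType) (d e r : nat) (zeta : C).
Hypotheses (d_gt1 : 1 < d) (e_gt0 : 0 < e) (r_ge3 : 2 < r).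
Hypothesis zeta_prim : ((d * e)%N.-primitive_root zeta)%R.

Local Notation B := (braid_group e r).
Local Notation Gr := (imprimitive_group C d e r).
Local Notation f := (braid_matrix r_ge3 zeta_prim).
Local Notation z := (braid_z e r).
Local Notation t := (braid_t e r).
Local Notation s := (braid_s e r).
Local Notation sg := (braid_affine_generator e r).
Local Notation elt := (affine_z_element e r).
Local Notation Q := (presented (reflection_relation d e r)).
Local Notation qg := (presented_gen (reflection_relation d e r)).

Lemma braid_affine_generator_braided i : braided (sg i) (sg (i + 1)%R).
Proof.
by have := braid_affine_satisfies e r_ge3 (affine_braid i); rewrite !big_seq3.
Qed.

Lemma braid_affine_generator_ind (H : B -> Prop) : H (t 0%R) ->
  (forall i, H (sg i) -> H (sg (i + 1)%R)) -> forall i, H (sg i).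
Proof.
(* The walk around the cycle starts at residue 2, where s_2 = t_0; adding r keeps the subtraction
   from truncating when [zrep i] is 1. *)
move=> H0 HS i; have -> : i = ((zrep i + r - 2)%N%:R + 2%:R)%R.
  rewrite -natrD subnK; last by lia.
  by rewrite natrD natr_Zp_r // addr0 natr_zrep.
elim: (_ - 2)%N => [|n IHn]; first by rewrite add0r braid_affine_generator2.
by rewrite -natr1 addrAC; apply: HS.
Qed.

Lemma braid_matrix_reflection_satisfies :
  satisfies (f \o elt) (reflection_relation d e r).
Proof.
move=> _ _ [u v uv||i].
- by rewrite -!gmulf_prod (affine_z_satisfies r_ge3 e_gt0 uv).
- rewrite big_nil prod_nseq; exact: braid_matrix_zd.
- rewrite big_seq2 big_nil; move: i.
  apply: (@braid_affine_generator_ind (fun b => f b * f b = 1)) => [|i].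
    exact: braid_matrix_t2.
  by apply: braided_involution; rewrite /braided -!gmulfM braid_affine_generator_braided.
Qed.

Lemma braid_matrix_presentation :
  is_presentation [set: Gr] (reflection_relation d e r) (fun x => f (elt x)).
Proof.
split=> [M|u v].
  split=> // _; have [||b <-] := @braid_matrix_surj _ _ _ _ _ d_gt1 e_gt0 r_ge3 zeta_prim r M.
  - by lia.
  - by move=> a ra ar; lia.
  have [w <-] := (proj1 (affine_z_presentation r_ge3 e_gt0) b).1 I.
  by exists w; rewrite gmulf_weval.
split=> [uv|]; last exact/congruent_weval/braid_matrix_reflection_satisfies.
have qgP := @presented_gen_satisfies _ (reflection_relation d e r).
have [q qE] : exists q : UMagmaMorphism.type B Q, forall x, q (elt x) = qg x.
  by apply: affine_z_universal => // u' v' uv'; apply/qgP/reflection_braid.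
have wE w : q (weval elt w) = presented_class (reflection_relation d e r) w.
  rewrite gmulf_weval -weval_presented_gen.
  by apply: eq_bigr => -[x c] _ /=; rewrite qE.
(* The matrix morphism factors through [Q], as the kernel computation requires. *)
have fq b : presented_map braid_matrix_reflection_satisfies (q b) = f b.
  have [w <-] := (proj1 (affine_z_presentation r_ge3 e_gt0) b).1 I.
  by rewrite wE presented_map_class gmulf_weval.
have sg2 i : q (sg i) * q (sg i) = 1.
  rewrite (qE (agen_s i)); have := qgP _ _ (reflection_s_order d e i).
  by rewrite big_seq2 big_nil.
have qs2 j : 3 <= j <= r -> q (s j) * q (s j) = 1.
  by move=> jr; rewrite -(braid_affine_generator_s e r_ge3 jr) sg2.
have qt2 i : q (t i) * q (t i) = 1.
  apply: braided_involution (qs2 3 _); last by lia.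
  by rewrite /braided -!gmulfM braid_s3t.
have qzd : q z ^+ d = 1.
  rewrite (qE agen_z); have := qgP _ _ (reflection_z_order d e r).
  by rewrite prod_nseq big_nil.
apply/presented_classP; rewrite -!wE; apply: divg1_eq; rewrite -gmulfF.
apply: (kernel_trivial (zeta_prim := zeta_prim) d_gt1 e_gt0 qt2 qs2 qzd) => [a b ab|].
  by rewrite -!fq ab.
by rewrite gmulfF !gmulf_weval [X in X / _]uv mulgV.
Qed.

Lemma elementary_conjg (M P : Gr) : elementary (val M) -> elementary (val (M ^ P)).
Proof. by apply: elementary_conj; rewrite mulVmx // imprimitive_unit. Qed.

Lemma braid_matrix_reflection x : is_reflection (val (f (elt x))).
Proof.
have r0 : 0 < r by lia.
have r1 : 1 < r by lia.
apply: elementary_reflection; case: x => [|i] /=.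
  rewrite braid_matrix_z.
  (* The image of z is 1 + (zeta^e - 1) E with E the first diagonal matrix unit; zeta^e differs from
     1 because 0 < e < de. *)
  exists (\col_a (if a == 0%N :> nat then zeta ^+ e - 1 else 0))%R, (eps C r 0).
  split.
  - apply/negP => /eqP/colP/(_ (Ordinal r0))/eqP; rewrite !mxE /= subr_eq0.
    rewrite -(prim_order_dvd zeta_prim) => /dvdn_leq; rewrite e_gt0 => /(_ isT).
    by rewrite -{2}[e]mul1n leq_pmul2r // leqNgt d_gt1.
  - by apply/negP => /eqP/rowP/(_ (Ordinal r0))/eqP; rewrite !mxE /= oner_eq0.
  - apply/matrixP => a b; rewrite !mxE big_ord1 !mxE -val_eqE /=.
    case: a b => [[|a] ar] [[|b] br] /=;
      rewrite ?mulr1n ?mulr0n ?mulr1 ?mulr0 ?mul0r ?addr0 ?add0r //.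
    by rewrite addrC subrK.
move: i; apply: (@braid_affine_generator_ind (fun b => elementary (val (f b)))) => [|i]; last first.
  move=> Hi; have := braid_affine_generator_braided i; move/braided_conjE => sE.
  (* By the braid relation, neighbouring generators are conjugate. *)
  have -> : sg (i + 1)%R = (sg i ^ (sg (i + 1)%R)^-1) ^ (sg i)^-1.
    by rewrite sE conjgK.
  by rewrite !gmulfJ; apply/elementary_conjg/elementary_conjg.
rewrite braid_matrix_t.
(* The transposition matrix is 1 - v v^T, where v = e_2 - e_1. *)
exists (\col_a ((a == 1%N :> nat)%:R - (a == 0%N :> nat)%:R))%R,
  (\row_a ((a == 0%N :> nat)%:R - (a == 1%N :> nat)%:R))%R; split.
- apply/negP => /eqP/colP/(_ (Ordinal r1))/eqP; rewrite !mxE /=.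
  by rewrite subr0 oner_eq0.
- apply/negP => /eqP/rowP/(_ (Ordinal r0))/eqP; rewrite !mxE /=.
  by rewrite subr0 oner_eq0.
- apply/matrixP => a b; rewrite !mxE big_ord1 !mxE -val_eqE /=.
  by case: a b => [[|[|a]] ar] [[|[|b]] br] /=;
    rewrite ?(oppr0, expr0z, subr0, sub0r, mulr1, mulr0, mul0r, mulrN1, opprK,
              subrr, add0r, addr0).
Qed.

End ReflectionPresentation.

Theorem theorem5p3 (d e r : nat) (d_ge2 : (2 <= d)%N) (e_ge1 : (1 <= e)%N)
    (r_ge3 : (3 <= r)%N) :
  [/\ infinite_order (braid_z e r),
      is_presentation (affine_subgroup e r) (affine_relation r)
        (braid_affine_generator e r),
      internal_semidirect_product
        (subgroup_generated [set braid_z e r]) (affine_subgroup e r),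
      is_presentation [set: braid_group e r] (affine_z_relation e r)
        (affine_z_element e r)
    & forall (R : realType) (zeta : R[i]),
        ((d * e)%N.-primitive_root zeta)%R ->
        exists f : {multiplicative braid_group e r ->
                                   imprimitive_group R[i] d e r},
        [/\ val (f (braid_z e r)) = z_matrix e r zeta,
            forall i : int, val (f (braid_t e r i)) = t_matrix r zeta i,
            forall (j : nat) (a b : 'I_r), (3 <= j <= r)%N ->
              a = (j - 2)%N :> nat -> b = (j - 1)%N :> nat ->
              val (f (braid_s e r j)) = tperm_mx a b,
            is_presentation [set: imprimitive_group R[i] d e r]
              (reflection_relation d e r)
              (fun x => f (affine_z_element e r x))
          & forall x : affine_z_generator r,
              is_reflection (val (f (affine_z_element e r x)))]].
Proof.
split.
- exact: braid_z_infinite_order.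
- exact: affine_presentation.
- exact: braid_semidirect.
- exact: affine_z_presentation.
move=> R zeta zeta_prim; exists (braid_matrix r_ge3 zeta_prim); split.
- exact: braid_matrix_z.
- exact: braid_matrix_t.
- exact: braid_matrix_s.
- exact: braid_matrix_presentation.
- exact: braid_matrix_reflection.
Qed.
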